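(* Let $T>0$, $d,m,p\in\mathbb N$, $x_0\in\mathbb R^d$, and let $f_0:\mathbb R^d\to\mathbb R^d$, $f:\mathbb R^d\to\mathbb R^{d\times m}$ and $c:\mathbb R^d\to\mathbb R^p$ be locally Lipschitz continuous. Suppose that there is a constant $\mathcal C$ such that $$2\langle x,f_0(x)\rangle+\|f(x)\|_F^2\le\mathcal C(1+\|x\|^2)\quad\text{for all }x\in\mathbb R^d.$$ For $u\in L^2([0,T];\mathbb R^m)$ let $x(\cdot;u)$ be the solution on $[0,T]$ of $$\dot x(t)=f_0(x(t))+f(x(t))u(t),\quad x(0)=x_0,$$ and let $y_i(\cdot;u)$ be the $i$th component of $y(\cdot;u)=c(x(\cdot;u))$, $i\in\{1,\dots,p\}$. Let $\mathcal K\subset L^2([0,T];\mathbb R^m)$ be compact. Then, for every $\varepsilon>0$ there exists an $\ell_i\in\mathcal W_{m+1}$ such that $$\sup_{t\in[0,T]}\ \sup_{u\in\mathcal K}\ |y_i(t;u)-\langle \ell_i,S_{0,t}(\hat U)\rangle|<\varepsilon ,$$ where, for each $u\in\mathcal K$, $\hat U(t)=(t,U(t)^\top)^\top\in\mathbb R^{m+1}$ with $U(t)=\int_0^t u(s)\,\mathrm ds$, $t\in[0,T]$, and $S_{0,t}(\hat U)$ is the signature of $\hat U$ over $[0,t]$.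
   Context: $\|\cdot\|$ is the Euclidean norm, $\|\cdot\|_F$ the Frobenius norm. A map $g$ on $\mathbb R^d$ is locally Lipschitz if for every $R>0$ there is $L_{g,R}>0$ with $\|g(x)-g(z)\|\le L_{g,R}\|x-z\|$ for all $\|x\|,\|z\|\le R$. Solutions of the controlled equation are absolutely continuous functions satisfying the associated integral equation; under the stated assumptions a unique global solution exists on $[0,T]$ for every $u\in L^2([0,T];\mathbb R^m)$. Signature: for a continuous path of bounded variation $X:[0,T]\to\mathbb R^{M}$ and $0\le a<b\le T$, the iterated (Riemann–Stieltjes) integrals are $X^{(k)}_{a,b}=\int\cdots\int_{a<s_1<\cdots<s_k<b}\mathrm dX(s_1)\otimes\cdots\otimes \mathrm dX(s_k)\in\mathbb R^{M^k}$, where $\otimes$ is the Kronecker product, and $S_{a,b}(X)=(1,{X^{(1)}_{a,b}}^\top,{X^{(2)}_{a,b}}^\top,\dots)^\top\in\prod_{k=0}^\infty\mathbb R^{M^k}$. For $a=b$ the iterated integrals vanish, so $S_{a,a}(X)=(1,0,0,\dots)^\top$. $\mathcal W_M=\bigoplus_{k=0}^\infty\mathbb R^{M^k}$, i.e. its elements have only finitely many nonzero entries, and $\langle\ell,S\rangle$ is the (finite) sum of products of corresponding entries of $\ell\in\mathcal W_M$ and $S\in\prod_{k=0}^\infty\mathbb R^{M^k}$. Here $M=m+1$. *)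

(* Defs.v *)
From HB Require Import structures.
From mathcomp Require Import all_boot all_order all_algebra.
From mathcomp Require Import ring mxtens.
From mathcomp Require Import all_classical all_reals all_analysis.
From mathcomp Require Import measurable_realfun hoelder.
Import Order.TTheory GRing.Theory Num.Theory.
Import numFieldNormedType.Exports.

Set Implicit Arguments.
Unset Strict Implicit.
Unset Printing Implicit Defensive.

Local Open Scope classical_set_scope.
Local Open Scope ring_scope.

(* Frobenius norm; on column vectors it is the Euclidean norm. The norm `|A|
   of the library is the maximum norm. *)
Definition enorm (R : realType) (a b : nat) (A : 'M[R]_(a, b)) : R :=
  Num.sqrt (\sum_i \sum_j A i j ^+ 2).

Definition dotp (R : realType) (n : nat) (x y : 'cV[R]_n) : R :=
  \sum_i x i 0 * y i 0.

Section enorm_theory.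
Variable R : realType.

Lemma sumr_cauchy_schwarz (I : finType) (a b : I -> R) :
  (\sum_i a i * b i) ^+ 2 <= (\sum_i a i ^+ 2) * (\sum_i b i ^+ 2).
Proof.
set S := \sum_i a i * b i; set A := \sum_i a i ^+ 2; set B := \sum_i b i ^+ 2.
have A0 : 0 <= A by apply: sumr_ge0 => i _; exact: sqr_ge0.
have [AE|An0] := eqVneq A 0.
  suff -> : S = 0 by rewrite expr0n/= AE mul0r.
  apply: big1 => i _; move/eqP: AE; rewrite psumr_eq0; last first.
    by move=> j _; exact: sqr_ge0.
  by move=> /allP/(_ i); rewrite mem_index_enum sqrf_eq0 => /(_ isT)/eqP ->;
     rewrite mul0r.
have Agt0 : 0 < A by rewrite lt_neqAle eq_sym An0.
have : 0 <= \sum_i (A * b i - S * a i) ^+ 2.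
  by apply: sumr_ge0 => i _; exact: sqr_ge0.
have -> : \sum_i (A * b i - S * a i) ^+ 2 = A * (A * B - S ^+ 2).
  rewrite (eq_bigr (fun i => A ^+ 2 * b i ^+ 2 + (- (A * S) *+ 2) * (a i * b i)
    + S ^+ 2 * a i ^+ 2)); last by move=> i _; ring.
  rewrite !big_split/= -!mulr_sumr -/A -/B -/S.
  by ring.
by rewrite pmulr_rge0// subr_ge0.
Qed.

Variables a b : nat.
Implicit Types A B : 'M[R]_(a, b).

Lemma enorm_ge0 A : 0 <= enorm A.
Proof. exact: sqrtr_ge0. Qed.

Lemma enorm_sqr A : enorm A ^+ 2 = \sum_i \sum_j A i j ^+ 2.
Proof.
by rewrite sqr_sqrtr//; do 2 (apply: sumr_ge0 => ? _); exact: sqr_ge0.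
Qed.

Lemma ler_enormD A B : enorm (A + B) <= enorm A + enorm B.
Proof.
rewrite -(@ler_pXn2r _ 2)// ?nnegrE ?addr_ge0 ?enorm_ge0//.
rewrite sqrrD !enorm_sqr !pair_bigA/=.
have -> : \sum_p (A + B) p.1 p.2 ^+ 2 = \sum_p A p.1 p.2 ^+ 2 +
    (\sum_p A p.1 p.2 * B p.1 p.2) *+ 2 + \sum_p B p.1 p.2 ^+ 2.
  rewrite -sumrMnl -!big_split/=; apply: eq_bigr => i _; rewrite mxE; ring.
rewrite lerD2r lerD2l lerMn2r/=.
rewrite (le_trans (ler_norm _))//.
rewrite -(@ler_pXn2r _ 2)// ?nnegrE ?mulr_ge0 ?enorm_ge0//.
rewrite real_normK ?num_real// exprMn !enorm_sqr !pair_bigA/=.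
exact: sumr_cauchy_schwarz.
Qed.

Lemma enormN A : enorm (- A) = enorm A.
Proof.
by congr Num.sqrt; do 2 (apply: eq_bigr => ? _); rewrite mxE sqrrN.
Qed.

Lemma enorm0_eq0 A : enorm A = 0 -> A = 0.
Proof.
move=> /(congr1 (fun x => x ^+ 2)); rewrite enorm_sqr expr0n/= pair_bigA/=.
move=> /eqP; rewrite psumr_eq0; last by move=> j _; exact: sqr_ge0.
move=> /allP A0; apply/matrixP => i j; rewrite mxE; apply/eqP.
by have := A0 (i, j); rewrite mem_index_enum sqrf_eq0; exact.
Qed.

Lemma enorm0 : enorm (0 : 'M[R]_(a, b)) = 0.
Proof.
rewrite /enorm big1 ?sqrtr0// => i _; rewrite big1// => j _.
by rewrite mxE expr0n.
Qed.

Lemma ler_enorm_sum A : enorm A <= \sum_i \sum_j `|A i j|.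
Proof.
rewrite -(@ler_pXn2r _ 2)// ?nnegrE ?enorm_ge0//; last first.
  by do 2 (apply: sumr_ge0 => ? _).
rewrite enorm_sqr !pair_bigA/= expr2 mulr_suml; apply: ler_sum => p _.
rewrite -real_normK ?num_real// expr2 ler_wpM2l//.
by rewrite (bigD1 p)//= lerDl sumr_ge0.
Qed.

End enorm_theory.

Definition lebesgue_on (R : realType) (T : R) :=
  mrestr (@lebesgue_measure R) (measurable_itv `[0, T]).
HB.instance Definition _ (R : realType) (T : R) := Measure.on (@lebesgue_on R T).

(* L^2([0,T]; R^m): m-tuples of classes of square integrable functions for the
   restriction of the Lebesgue measure to [0,T]. *)
Definition L2 (R : realType) (T : R) (m : nat) : Type :=
  'I_m -> LspaceType2 (@lebesgue_on R T).
HB.instance Definition _ (R : realType) (T : R) (m : nat) :=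
  gen_eqMixin (@L2 R T m).
HB.instance Definition _ (R : realType) (T : R) (m : nat) :=
  gen_choiceMixin (@L2 R T m).

(* The pointwise values are those of a chosen representative of the class. *)
Definition L2fun (R : realType) (T : R) (m : nat) (u : L2 T m) (s : R) : 'cV[R]_m :=
  \col_i u i s.

Definition L2dist (R : realType) (T : R) (m : nat) (u v : L2 T m) : R :=
  fine (Lnorm (@lebesgue_on R T) 2%:E
    (fun s => (enorm (L2fun u s - L2fun v s))%:E)).

Section L2_metric.
Variables (R : realType) (T : R) (m : nat).
Implicit Types u v w : L2 T m.
Let mu := @lebesgue_on R T.

Let le_Lnorm2 (f g : R -> R) : measurable_fun setT f -> measurable_fun setT g ->
  (forall s, 0 <= f s <= g s) ->
  (Lnorm mu 2%:E (EFin \o f) <= Lnorm mu 2%:E (EFin \o g))%E.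
Proof.
move=> mf mg fg; rewrite unlock.
have mp (h : R -> R) : measurable_fun setT h ->
    measurable_fun setT (fun x => `|h x| `^ 2).
  move=> mh; apply: (@measurableT_comp _ _ _ _ _ _ (@powR R ^~ 2)) => //.
  exact: measurableT_comp.
apply: gt0_ler_poweR; rewrite ?invr_ge0// ?in_itv/= ?andbT ?leey ?integral_ge0//.
apply: ge0_le_integral => //=; [by apply/measurable_EFinP; exact: mp|
  by apply/measurable_EFinP; exact: mp|move=> s _].
have /andP[f0 fgs] := fg s.
rewrite lee_fin ge0_ler_powR// ?nnegrE// !ger0_norm//.
exact: le_trans fgs.
Qed.

Let measurable_L2 u i : measurable_fun setT (u i : R -> R).
Proof. exact: (@measurable_funPT _ _ _ _ (repr (LebesgueSpace.sort (u i)))). Qed.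

Let L2_Lfun u i : (u i : R -> R) \in Lfun mu 2%:E.
Proof.
rewrite inE; apply/andP; split; apply: mem_set; first exact: measurable_L2.
exact: Lebesgue_finite.
Qed.

Let enormBE u v s : enorm (L2fun u s - L2fun v s) =
  Num.sqrt (\sum_i (u i s - v i s) ^+ 2).
Proof.
by congr Num.sqrt; apply: eq_bigr => i _; rewrite big_ord1 !mxE.
Qed.

Let measurable_enormB u v :
  measurable_fun setT (fun s => enorm (L2fun u s - L2fun v s)).
Proof.
under eq_fun do rewrite enormBE.
apply: measurableT_comp => //.
  exact: (continuous_measurable_fun (@sqrt_continuous R)).
apply: measurable_sum => i; apply: measurable_funX.
by apply: measurable_funB; exact: measurable_L2.
Qed.

Let L2dist_fin u v :
  (Lnorm mu 2%:E (fun s => (enorm (L2fun u s - L2fun v s))%:E) < +oo)%E.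
Proof.
pose g := \sum_i (fun s => `|u i s - v i s|).
have mg i : measurable_fun setT (fun s => `|u i s - v i s|).
  by apply: measurableT_comp => //; apply: measurable_funB; exact: measurable_L2.
have gL : g \in Lfun mu 2%:E.
  apply: (big_ind (fun h => h \in Lfun mu 2%:E)).
  - by have := Lfun_submod_closed mu (lee1n 2); case.
  - by move=> x y; apply: (Lfun_addr_closed mu (lee1n 2)).2.
  move=> i _; rewrite inE; apply/andP; split; apply: mem_set; first exact: mg.
  rewrite /= /finite_norm.
  have : (fun s => u i s - v i s) \in Lfun mu 2%:E.
    have Nv := Lfun_oppr_closed (L2_Lfun v i).
    exact: ((Lfun_addr_closed mu (lee1n 2)).2 _ _ (L2_Lfun u i) Nv).
  rewrite inE => /andP[_] /set_mem /=.
  by rewrite /finite_norm -Lnorm_abse.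
move: (gL); rewrite inE => /andP[/set_mem/= mg' /set_mem/=].
apply: le_lt_trans; apply: le_Lnorm2; [exact: measurable_enormB|exact: mg'|move=> s].
rewrite enorm_ge0/= (le_trans (ler_enorm_sum _))// /g fct_sumE.
by apply: ler_sum => i _; rewrite big_ord1 !mxE.
Qed.

Let L2distE u v : (L2dist u v)%:E =
  Lnorm mu 2%:E (fun s => (enorm (L2fun u s - L2fun v s))%:E).
Proof.
rewrite /L2dist fineK// fin_numElt L2dist_fin andbT.
by rewrite (lt_le_trans ltNy0)// Lnorm_ge0.
Qed.

Let L2distxx u : L2dist u u = 0.
Proof.
apply: EFin_inj; rewrite L2distE -[RHS](@Lnorm0 _ _ _ mu 2)//.
by apply: eq_Lnorm => s; rewrite subrr enorm0.
Qed.

Let L2_ext (f g : LspaceType2 (@lebesgue_on R T)) :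
  (\forall s \ae mu, f s = g s) -> f = g.
Proof.
case: f g => [f fP] [g gP] /= fg.
have {}fg : f = g.
  rewrite -[f]reprK -[g]reprK; apply/eqmodP; apply/asboolP.
  by apply: filterS fg => s fgs _.
by subst g; congr LebesgueSpace.Pack; case: fP gP => [[?]] [[?]];
  do 2 congr (_ _); exact: Prop_irrelevance.
Qed.

Let L2dist_positivity u v : L2dist u v = 0 -> u = v.
Proof.
move=> uv0; have := L2distE u v; rewrite uv0 => /esym.
move=> /Lnorm_eq0_eq0 => /(_ _ _)/wrap[].
  by apply/measurable_EFinP; exact: measurable_enormB.
  by [].
move=> ae0; apply/funext => i; apply: L2_ext.
apply: filterS ae0 => s /(_ I) /= [] /enorm0_eq0 /matrixP/(_ i 0).
by rewrite !mxE => /eqP; rewrite subr_eq0 => /eqP.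
Qed.

Let L2dist_sym u v : L2dist u v = L2dist v u.
Proof.
by congr fine; apply: eq_Lnorm => s; rewrite -enormN opprB.
Qed.

Let L2dist_triangle v u w : L2dist u w <= L2dist u v + L2dist v w.
Proof.
rewrite -lee_fin EFinD !L2distE.
set f := fun s => enorm (L2fun u s - L2fun v s).
set g := fun s => enorm (L2fun v s - L2fun w s).
have mf : measurable_fun setT f by exact: measurable_enormB.
have mg : measurable_fun setT g by exact: measurable_enormB.
apply: (@le_trans _ _ (Lnorm mu 2%:E (EFin \o (f \+ g)))); last first.
  by apply: minkowski_EFin => //; rewrite ler1n.
apply: le_Lnorm2; [exact: measurable_enormB|exact: measurable_funD|move=> s].
rewrite enorm_ge0/= (_ : L2fun u s - L2fun w s =
  (L2fun u s - L2fun v s) + (L2fun v s - L2fun w s)) ?ler_enormD//.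
by rewrite addrA subrK.
Qed.

HB.instance Definition _ := @isMetric.Build R (L2 T m) (@L2dist R T m)
  L2distxx L2dist_positivity L2dist_sym L2dist_triangle.

End L2_metric.

Definition locally_lipschitz (R : realType) (d a b : nat)
    (g : 'cV[R]_d -> 'M[R]_(a, b)) : Prop :=
  forall r : R, 0 < r -> exists2 L : R, 0 < L &
    forall x z, enorm x <= r -> enorm z <= r ->
      enorm (g x - g z) <= L * enorm (x - z).

Definition absolutely_continuous (R : realType) (d : nat) (a b : R)
    (x : R -> 'cV[R]_d) : Prop :=
  forall e : R, 0 < e -> exists2 delta : R, 0 < delta &
    forall (n : nat) (l r : 'I_n -> R),
      (forall i, a <= l i /\ l i <= r i /\ r i <= b) ->
      trivIset setT (fun i => `]l i, r i[%classic) ->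
      \sum_i (r i - l i) < delta -> \sum_i enorm (x (r i) - x (l i)) < e.

Definition vintegrable (R : realType) (n : nat) (D : set R)
    (g : R -> 'cV[R]_n) : Prop :=
  forall i, (@lebesgue_measure R).-integrable D (fun s => (g s i 0)%:E).

Definition vintegral (R : realType) (n : nat) (D : set R)
    (g : R -> 'cV[R]_n) : 'cV[R]_n :=
  \col_i (\int[@lebesgue_measure R]_(s in D) g s i 0)%R.

Definition is_solution (R : realType) (T : R) (d m : nat) (x0 : 'cV[R]_d)
    (f0 : 'cV[R]_d -> 'cV[R]_d) (f : 'cV[R]_d -> 'M[R]_(d, m))
    (u : L2 T m) (x : R -> 'cV[R]_d) : Prop :=
  let rhs s := f0 (x s) + f (x s) *m L2fun u s in
  absolutely_continuous 0 T x /\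
  forall t, t \in `[0, T] ->
    vintegrable `[0, t] rhs /\ x t = x0 + vintegral `[0, t] rhs.

(* Riemann-Stieltjes integral of g against h over [a, b], as the limit of the
   tagged sums when the mesh tends to 0. The partition a = s_0 < ... < s_n = b
   is given by the sequence s_1, ..., s_n. *)
Definition is_RSint (R : realType) (a b : R) (g h : R -> R) (v : R) : Prop :=
  forall e : R, 0 < e -> exists2 delta : R, 0 < delta &
    forall (s : seq R) (tau : nat -> R), itv_partition a b s ->
      let pt := nth b (a :: s) in
      (forall i, (i < size s)%N ->
        pt i.+1 - pt i < delta /\ pt i <= tau i <= pt i.+1) ->
      `|\sum_(i < size s) g (tau i) * (h (pt i.+1) - h (pt i)) - v| < e.

(* 0 when the integral does not exist. *)
Definition RSint (R : realType) (a b : R) (g h : R -> R) : R :=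
  xget 0 [set v | is_RSint a b g h v].

(* The integral over [a, b] of the Kronecker product of g and dX, entry by
   entry: mxtens_unindex is the indexing of the entries of the Kronecker
   product tensmx, see tensmxE. *)
Definition tens_RSint (R : realType) (n M : nat) (a b : R)
    (g : R -> 'cV[R]_n) (X : R -> 'cV[R]_M) : 'cV[R]_(n * M) :=
  \col_q RSint a b (fun s => g s (mxtens_unindex q).1 0)
                   (fun s => X s (mxtens_unindex q).2 0).

(* The integral over the simplex a < s_1 < ... < s_k < b is computed by
   integrating over the largest variable s_k last. *)
Fixpoint iterated_integral (R : realType) (M : nat) (X : R -> 'cV[R]_M)
    (k : nat) (a b : R) : 'cV[R]_(M ^ k) :=
  match k with
  | 0 => const_mx 1
  | k'.+1 => castmx (esym (expnSr M k'), erefl)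
      (tens_RSint a b (fun s => iterated_integral X k' a s) X)
  end.

(* \prod_k R^(M^k). *)
Definition tensor_series (R : realType) (M : nat) : Type :=
  forall k : nat, 'cV[R]_(M ^ k).

Definition signature (R : realType) (M : nat) (a b : R)
    (X : R -> 'cV[R]_M) : tensor_series R M :=
  fun k => iterated_integral X k a b.

(* The finitely supported elements, \bigoplus_k R^(M^k). *)
Record tensor_poly (R : realType) (M : nat) := TensorPoly {
  tcoef : tensor_series R M;
  tcoef_finite : finite_set [set k | tcoef k != 0] }.

Definition pairing (R : realType) (M : nat) (l : tensor_poly R M)
    (S : tensor_series R M) : R :=
  \sum_(k \in [set: nat]) dotp (tcoef l k) (S k).

Definition primitive (R : realType) (T : R) (m : nat) (u : L2 T m) (t : R) :
    'cV[R]_m :=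
  vintegral `[0, t] (L2fun u).

(* The path t |-> (t, U(t)). *)
Definition time_augmented (R : realType) (T : R) (m : nat) (u : L2 T m)
    (t : R) : 'cV[R]_m.+1 :=
  col_mx t%:M (primitive u t).

(* Main.v *)
Require Import Defs.
From HB Require Import structures.
From mathcomp Require Import all_boot all_order all_algebra.
From mathcomp Require Import ring lra mxtens.
From mathcomp Require Import all_classical all_reals all_analysis.
From mathcomp Require Import measurable_realfun hoelder.
Import Order.TTheory GRing.Theory Num.Theory.
Import numFieldNormedType.Exports.

(** The output [c (x u t) i 0] is a continuous function of the pair (t, u), and
on the compact set [0, T] x K it is approximated by the Stone-Weierstrass
theorem, applied to the linear combinations of coordinates of the signature.
Two pairs such as (t, u) and (t, v) with u = v on [0, t] have the same
signature, so this algebra does not separate points, and the form of the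
theorem that is proved ([stone_weierstrass]) only asks the algebra to separate
the points at which the approximated function differs.

Signature coordinates as Lebesgue integrals.  The path (t, U(t)) is a primitive
of the integrable densities (1, u_1, ..., u_m), and the Riemann-Stieltjes
integral of a continuous function against a primitive is the Lebesgue integral
against the density ([is_RSint_primitive]).  The coordinates of the signature
are thus the iterated integrals [word_integral], one for each word in the
letters 0, ..., m ([iterated_integralE]).

Algebra.  Integration by parts holds for Riemann-Stieltjes integrals by
summation by parts ([is_RSint_by_parts]); hence the product rule for primitives
of integrable functions ([primitive_product_rule]), and by induction on the
words a product of two word integrals is a combination of word integrals
([word_integral_shuffle]).

Continuity.  For a fixed control everything is a primitive, hence continuous in
time.  In the control, both the word integrals ([word_integral_stable]) and the
trajectories ([controlled_solution_stable]) are stable, uniformly in time, for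
the L1 distance, which the L2 distance dominates ([L1_le_L2dist]).  For the
trajectories this is Gronwall's inequality with an integrable kernel.  The
vector fields are Lipschitz only near the reference trajectory, so the
inequality is localized ([gronwall_local]): a trajectory that left a unit tube
would have to cross its boundary, where the estimate still holds and is smaller
than 1.

Separation.  If all the words agree at (t, u) and (r, v), the letter 0 gives
t = r.  The words made of the letter j followed by letters 0 show that u_j - v_j
is orthogonal on [0, t] to all polynomials in time, hence to all continuous
functions, hence vanishes almost everywhere
([word_integrals_determine]); then the two trajectories coincide up to time t
([controlled_solution_unique]). *)

Set Implicit Arguments.
Unset Strict Implicit.
Unset Printing Implicit Defensive.

Local Open Scope classical_set_scope.
Local Open Scope ring_scope.

(** * The Stone-Weierstrass theorem *)

(** Induction over a compact set: a property of sets that is local and stable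
under finite unions passes to the whole set. Indeed, if it failed for [Q], the
complements of the sets satisfying it would generate a proper filter on [Q]
without a cluster point. *)
Lemma compact_ind (X : topologicalType) (Q : set X) (P : set X -> Prop) :
  compact Q -> P set0 ->
  (forall U V, U `<=` V -> P V -> P U) ->
  (forall U V, P U -> P V -> P (U `|` V)) ->
  (forall q, Q q -> exists2 V, nbhs q V & P (Q `&` V)) ->
  P Q.
Proof.
move=> cQ P0 Psub PU Ploc; apply: contrapT => nPQ.
pose F := [set U | P (Q `\` U)].
have FF : ProperFilter F.
  apply: Build_ProperFilter_ex.
    move=> U FU; apply: contrapT => nU; apply: nPQ; apply: Psub FU => x Qx.
    by split => // Ux; apply: nU; exists x.
  split => /=.
  - by rewrite /F/= setDT.
  - move=> U V FU FV; apply: (Psub _ _ _ (PU _ _ FU FV)) => x [Qx nUV].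
    by have [Ux|nUx] := pselect (U x); [right|left]; split => // Vx; apply: nUV.
  - by move=> U V UV; apply: Psub => x [Qx nVx]; split => // /UV.
have FQ : F Q by rewrite /F/= setDv.
have [q [Qq clq]] := cQ F FF FQ.
have [V qV PV] := Ploc q Qq.
have [x [nVx Vx]] : ~` V `&` V !=set0.
  by apply: clq => //; rewrite /F/= setDE setCK.
exact: nVx.
Qed.

Lemma within_continuous_near (R : realType) (X : topologicalType) (Q : set X) (f : X -> R) :
  {within Q, continuous f} <->
  (forall x, Q x -> forall e : R, 0 < e ->
    \forall y \near x, Q y -> `|f x - f y| < e).
Proof.
split=> [/subspace_continuousP cf x Qx e e0|cf].
  by have /cvgrPdist_lt /(_ _ e0) := cf x Qx.
apply/subspace_continuousP => x Qx; apply/cvgrPdist_lt => e e0.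
exact: cf.
Qed.

Section stone_weierstrass.
Context {R : realType} {X : topologicalType} (Q : set X) (A : set (X -> R)).
Implicit Types f g : X -> R.

Let near_cont f := forall x, Q x -> forall e : R, 0 < e ->
  \forall y \near x, Q y -> `|f x - f y| < e.

Let within_near_cont f : {within Q, continuous f} -> near_cont f.
Proof. exact: (within_continuous_near Q f).1. Qed.

Let unif_closure : set (X -> R) := [set f |
  forall e : R, 0 < e -> exists2 a, A a & forall x, Q x -> `|f x - a x| < e].

Hypotheses (cQ : compact Q) (A1 : A (cst 1))
  (AD : forall f g, A f -> A g -> A (fun x => f x + g x))
  (AM : forall f g, A f -> A g -> A (fun x => f x * g x))
  (AZ : forall (k : R) f, A f -> A (fun x => k * f x))
  (Acont : forall f, A f -> {within Q, continuous f}).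

Let Acst (k : R) : A (cst k).
Proof. by have := AZ k A1; rewrite (_ : (fun _ => _) = cst k)//; apply/funext => x /=; rewrite mulr1. Qed.

Let Asub f g : A f -> A g -> A (fun x => f x - g x).
Proof.
move=> Af Ag; have := AD Af (AZ (-1) Ag).
by congr A; apply/funext => x; rewrite mulN1r.
Qed.

Let A_bounded f : A f -> exists2 M : R, 0 < M & forall x, Q x -> `|f x| <= M.
Proof.
move=> /Acont/within_near_cont cf.
pose P U := exists2 M : R, 0 < M & forall x, U x -> Q x -> `|f x| <= M.
have [|||q Qq|M M0 fM] := @compact_ind X Q P cQ.
- by exists 1.
- by move=> U V UV [M M0 fM]; exists M => // x /UV; exact: fM.
- move=> U V [M M0 fM] [N N0 fN]; exists (M + N); first exact: addr_gt0.
  move=> x [Ux Qx|Vx Qx].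
    by rewrite (le_trans (fM _ Ux Qx))// lerDl ltW.
  by rewrite (le_trans (fN _ Vx Qx))// lerDr ltW.
- exists [set y | Q y -> `|f q - f y| < 1]; first exact: cf.
  exists (`|f q| + 1) => [|x [Qx /(_ Qx) fqx _]]; first by rewrite ltr_wpDl.
  rewrite (_ : f x = f q - (f q - f x)); last by rewrite subKr.
  by rewrite (le_trans (ler_normB _ _))// lerD2l ltW.
by exists M => // x Qx; exact: fM.
Qed.

(** Polynomials in [b] that increase to the absolute value of [b] when it is at
most 1, by fixed-point iteration for the equation q ^ 2 = b ^ 2. *)
Let sqrt_iter (b : X -> R) n : X -> R :=
  iter n (fun q x => q x + 2^-1 * (b x * b x - q x * q x)) (cst 0).

(** The error t = |b| - q satisfies t' <= t - t ^ 2 / 2, and the bound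
2 / (n + 2) is preserved by this recursion. *)
Let sqrt_iterP b n x : `|b x| <= 1 ->
  [/\ 0 <= sqrt_iter b n x, sqrt_iter b n x <= `|b x| &
      `|b x| - sqrt_iter b n x <= 2 / n.+2%:R].
Proof.
move=> b1; elim: n => [|n] /=.
  by rewrite subr0 divff//; split.
rewrite -/(sqrt_iter b n); move: (sqrt_iter b n x) => q [q0 qb bq].
have -> : b x * b x = `|b x| * `|b x| by rewrite -normrM ger0_norm// -expr2 sqr_ge0.
move: `|b x| b1 (normr_ge0 (b x)) qb bq => {}b b1 b0 qb bq.
split; [nra|nra|].
have n2 : 2 / n.+2%:R <= 1 :> R by rewrite ler_pdivrMr ?ltr0n// mul1r ler_nat.
have n3 : 2 / n.+2%:R - 2^-1 * (2 / n.+2%:R) ^+ 2 <= 2 / n.+3%:R :> R.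
  rewrite -subr_ge0.
  have -> : 2 / n.+3%:R - (2 / n.+2%:R - 2^-1 * (2 / n.+2%:R) ^+ 2) =
     2 / (n.+3%:R * n.+2%:R ^+ 2) :> R.
    rewrite -[n.+3%:R]natr1 -[n.+2%:R]natr1 -[n.+1%:R]natr1.
    have n0 : 0 <= n%:R :> R := ler0n _ _.
    by field; apply/andP; split; lra.
  by rewrite divr_ge0// mulr_ge0// exprn_ge0.
apply: le_trans n3; set t := 2 / _ in bq n2 *.
by nra.
Qed.

Let closure_abs f : A f -> unif_closure (fun x => `|f x|).
Proof.
move=> Af e e0; have [M M0 fM] := A_bounded Af.
pose b x := M^-1 * f x.
have Ab : A b by exact: AZ.
have Aq n : A (sqrt_iter b n).
  by elim: n => [|n IH]; [exact: Acst|apply: AD => //; apply: AZ; apply: Asub; exact: AM].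
have [n ne] : exists n, M * (2 / n.+2%:R) < e.
  exists (Num.bound (M * 2 / e)).
  rewrite mulrA ltr_pdivrMr ?ltr0n// [e * _]mulrC -ltr_pdivrMr//.
  have Me0 : 0 <= M * 2 / e by rewrite divr_ge0 ?mulr_ge0 ?ltW.
  by rewrite (lt_trans (archi_boundP Me0))// ltr_nat.
exists (fun x => M * sqrt_iter b n x); first exact: AZ.
move=> x Qx; have b1 : `|b x| <= 1.
  by rewrite normrM gtr0_norm ?invr_gt0// mulrC ler_pdivrMr// mul1r fM.
have [q0 qb bq] := sqrt_iterP n b1.
have -> : `|f x| = M * `|b x|.
  by rewrite normrM gtr0_norm ?invr_gt0// mulVKf// gt_eqF.
rewrite -mulrBr normrM gtr0_norm// ger0_norm ?subr_ge0//.
by apply: le_lt_trans ne; rewrite ler_pM2l.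
Qed.

Let closure_sub f g : unif_closure f -> unif_closure g ->
  unif_closure (fun x => f x - g x).
Proof.
move=> Bf Bg e e0; have e20 : 0 < e / 2 by rewrite divr_gt0.
have [a Aa fa] := Bf _ e20; have [b Ab gb] := Bg _ e20.
exists (fun x => a x - b x); first exact: Asub.
move=> x Qx; have := fa x Qx; have := gb x Qx.
rewrite !ltr_norml => /andP[? ?] /andP[? ?]; apply/andP; split; lra.
Qed.

(** Since max(f, g) = (f + g + |f - g|) / 2, absolute values give the lattice
operations. *)
Let closure_max f g : unif_closure f -> unif_closure g ->
  unif_closure (fun x => Num.max (f x) (g x)).
Proof.
move=> Bf Bg e e0; have e20 : 0 < e / 2 by rewrite divr_gt0.
have [a Aa fa] := Bf _ e20; have [b Ab gb] := Bg _ e20.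
have [c Ac abc] := closure_abs (Asub Aa Ab) e0.
exists (fun x => 2^-1 * (a x + b x + c x)); first by apply: AZ; apply: AD => //; exact: AD.
move=> x Qx; have := fa x Qx; have := gb x Qx; have := abc x Qx.
have [ab|ab] := ler0P (a x - b x); have [fg|fg] := leP (f x) (g x);
  rewrite !ltr_norml => /andP[? ?] /andP[? ?] /andP[? ?];
  apply/andP; split; lra.
Qed.

Let closure_min f g : unif_closure f -> unif_closure g ->
  unif_closure (fun x => Num.min (f x) (g x)).
Proof.
move=> Bf Bg.
have B0 : unif_closure (cst 0) by move=> e e0; exists (cst 0) => //= x _; rewrite subrr normr0.
have := closure_sub B0 (closure_max (closure_sub B0 Bf) (closure_sub B0 Bg)).
by congr unif_closure; apply/funext => x /=; rewrite !sub0r oppr_max !opprK.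
Qed.

Let sub_closure f : A f -> unif_closure f.
Proof. by move=> Af e e0; exists f => // x _; rewrite subrr normr0. Qed.

Let closure_near_cont f : unif_closure f -> near_cont f.
Proof.
move=> Bf x Qx e e0; have e30 : 0 < e / 3 by rewrite divr_gt0.
have [a Aa fa] := Bf _ e30.
have := within_near_cont (Acont Aa) Qx e30; apply: filterS => y axy Qy.
have := axy Qy; have := fa x Qx; have := fa y Qy.
rewrite !ltr_norml => /andP[? ?] /andP[? ?] /andP[? ?]; apply/andP; split; lra.
Qed.

(** The lattice argument. Two-point interpolation is possible for any [f] that is
constant wherever the algebra is. A minimum of finitely many interpolants
through [p] stays below [f + e]; a maximum of finitely many such minima is in
addition above [f - e]. *)
Theorem stone_weierstrass f : {within Q, continuous f} ->
  (forall p q, Q p -> Q q -> f p <> f q -> exists2 a, A a & a p <> a q) ->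
  forall e : R, 0 < e -> exists2 a, A a & forall x, Q x -> `|f x - a x| < e.
Proof.
move=> /within_near_cont cf sep.
suff : unif_closure f by [].
have interp p q : Q p -> Q q -> exists a, [/\ A a, a p = f p & a q = f q].
  move=> Qp Qq; have [fpq|/(sep _ _ Qp Qq)[a Aa apq]] := pselect (f p = f q).
    by exists (cst (f p)); split.
  have apq0 : a q - a p != 0 by rewrite subr_eq0; apply/eqP => /esym.
  exists (fun x => f p + (f q - f p) / (a q - a p) * (a x - a p)); split.
  - by apply: AD; [exact: Acst|apply: AZ; apply: Asub => //; exact: Acst].
  - by rewrite subrr mulr0 addr0.
  - by rewrite divfK// addrC subrK.
suff fe : forall e : R, 0 < e -> exists2 g, unif_closure g &
    forall x, Q x -> f x - e < g x < f x + e.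
  move=> e e0; have e20 : 0 < e / 2 by rewrite divr_gt0.
  have [g Bg fg] := fe _ e20; have [a Aa ga] := Bg _ e20; exists a => // x Qx.
  have := fg x Qx; have := ga x Qx.
  rewrite !ltr_norml => /andP[? ?] /andP[? ?]; apply/andP; split; lra.
move=> e e0; have e20 : 0 < e / 2 by rewrite divr_gt0.
have below p : Q p -> exists g, [/\ unif_closure g, g p = f p &
    forall x, Q x -> g x < f x + e].
  move=> Qp; pose P U := exists g, [/\ unif_closure g, g p = f p &
    forall x, U x -> Q x -> g x < f x + e].
  have [|||q Qq|g [Bg gp gf]] := @compact_ind X Q P cQ.
  - by exists (cst (f p)); split => //; apply: sub_closure; exact: Acst.
  - by move=> U V UV [g [Bg gp gf]]; exists g; split => // x /UV; exact: gf.
  - move=> U V [g [Bg gp gf]] [h [Bh hp hf]].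
    exists (fun x => Num.min (g x) (h x)); split.
    + exact: closure_min.
    + by rewrite gp hp minxx.
    + move=> x [Ux|Vx] Qx; rewrite gt_min; first by rewrite gf.
      by rewrite hf ?orbT.
  - have [a [Aa ap aq]] := interp p q Qp Qq.
    pose V := [set y | (Q y -> `|f q - f y| < e / 2) /\ (Q y -> `|a q - a y| < e / 2)].
    exists V.
      apply: filterI; first exact: cf.
      exact: within_near_cont (Acont Aa) _ Qq _ e20.
    exists a; split => //; first exact: sub_closure.
    move=> x [Qx [/(_ Qx) + /(_ Qx) +]] _.
    by rewrite aq !ltr_norml => /andP[? ?] /andP[? ?]; lra.
  by exists g; split => // x Qx; exact: gf.
pose P U := exists2 g, unif_closure g & (forall x, Q x -> g x < f x + e) /\
  (forall x, U x -> Q x -> f x - e < g x).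
have [[q0 Qq0]|Q0] := pselect (Q !=set0); last first.
  by exists (cst 0); [apply: sub_closure; exact: Acst|move=> x Qx; case: Q0; exists x].
have [|||q Qq|g Bg [gf fg]] := @compact_ind X Q P cQ.
- by have [g [Bg _ gf]] := below _ Qq0; exists g.
- by move=> U V UV [g Bg [gf fg]]; exists g => //; split => // x /UV; exact: fg.
- move=> U V [g Bg [gf fg]] [h Bh [hf fh]].
  exists (fun x => Num.max (g x) (h x)); first exact: closure_max.
  split=> [x Qx|x [Ux|Vx] Qx]; first by rewrite gt_max gf ?hf.
    by rewrite lt_max fg.
  by rewrite lt_max fh ?orbT.
- have [g [Bg gq gf]] := below _ Qq.
  pose V := [set y | (Q y -> `|f q - f y| < e / 2) /\ (Q y -> `|g q - g y| < e / 2)].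
  exists V.
    apply: filterI; first exact: cf.
    exact: closure_near_cont.
  exists g => //; split => // x [Qx [/(_ Qx) + /(_ Qx) +]] _.
  by rewrite gq !ltr_norml => /andP[? ?] /andP[? ?]; lra.
by exists g => // x Qx; rewrite fg// gf.
Qed.

End stone_weierstrass.


(** * Integrals over segments and Riemann-Stieltjes integrals *)

Section segment_integral.
Context {R : realType}.
Implicit Types (a b c : R) (g h F G : R -> R).
Let mu := @lebesgue_measure R.

Lemma heine_cantor a b g : {within `[a, b], continuous g} ->
  forall e : R, 0 < e -> exists2 delta : R, 0 < delta &
    forall s t, s \in `[a, b] -> t \in `[a, b] -> `|s - t| < delta ->
      `|g s - g t| < e.
Proof.
move=> /within_continuous_near cg e e0; have e20 : 0 < e / 2 by rewrite divr_gt0.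
pose P U := exists2 delta : R, 0 < delta &
    forall s t, U s -> s \in `[a, b] -> t \in `[a, b] -> `|s - t| < delta ->
      `|g s - g t| < e.
have [|||q Qq|d d0 gd] := @compact_ind _ `[a, b]%classic P (@segment_compact _ a b).
- by exists 1.
- by move=> U V UV [d d0 gd]; exists d => // s t /UV; exact: gd.
- move=> U V [d d0 gd] [d' d'0 gd']; exists (Num.min d d') => [|s t UV sab tab].
    by rewrite lt_min d0.
  by rewrite lt_min => /andP[std std']; case: UV => [Us|Vs]; [exact: gd|exact: gd'].
- have /nbhs_ballP[/= d d0 gd] := cg q Qq _ e20.
  have d20 : 0 < d / 2 by rewrite divr_gt0.
  exists (ball q (d / 2)); first exact: nbhsx_ballx.
  exists (d / 2) => // s t [_ qs] sab tab st.
  have /(_ sab) qgs : `[a, b]%classic s -> `|g q - g s| < e / 2.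
    apply: gd; apply: le_ball qs.
    by rewrite ler_pdivrMr// ler_peMr ?ler1n// ltW.
  have /(_ tab) qgt : `[a, b]%classic t -> `|g q - g t| < e / 2.
    apply: gd; rewrite /ball/=.
    rewrite (_ : q - t = (q - s) + (s - t)); last by rewrite addrA subrK.
    by rewrite (le_lt_trans (ler_normD _ _))// (splitr d) ltrD.
  by move: qgs qgt; rewrite !ltr_norml => /andP[? ?] /andP[? ?]; apply/andP; split; lra.
by exists d => // s t sab; exact: gd.
Qed.

Lemma integrable_subitv a b c d h : a <= c -> d <= b ->
  mu.-integrable `[a, b] (EFin \o h) -> mu.-integrable `[c, d] (EFin \o h).
Proof.
move=> ac db; apply: integrableS => //.
by apply: subset_itv; rewrite bnd_simp.
Qed.

Lemma Rintegral_itv_cat a c b h : a <= c -> c <= b ->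
  mu.-integrable `[a, b] (EFin \o h) ->
  (\int[mu]_(s in `[a, b]) h s)%R =
  (\int[mu]_(s in `[a, c]) h s)%R + (\int[mu]_(s in `[c, b]) h s)%R.
Proof.
move=> ac cb ih; have := @Rintegral_itvB R h (BLeft a) (BRight b) c ih.
rewrite !bnd_simp => /(_ ac cb) /eqP; rewrite subr_eq => /eqP ->.
rewrite addrC Rintegral_itv_obnd_cbnd//.
by apply: integrableS ih => //; apply: subset_itvr; rewrite bnd_simp.
Qed.

Lemma integrable_contM a b g h : {within `[a, b], continuous g} ->
  mu.-integrable `[a, b] (EFin \o h) ->
  mu.-integrable `[a, b] (EFin \o (fun s => g s * h s)).
Proof.
move=> cg ih.
have -> : EFin \o (fun s => g s * h s) = ((EFin \o g) \* (EFin \o h))%E.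
  by apply/funext => s; rewrite /= EFinM.
apply: integrableMr => //; first exact: subspace_continuous_measurable_fun.
have := compact_bounded (continuous_compact cg (@segment_compact _ a b)).
case=> M [Mreal gM]; exists M; split => // N MN s sab.
by apply: gM => //; exists s.
Qed.

Lemma within_continuous_itvS a b c d g : a <= c -> d <= b ->
  {within `[a, b], continuous g} -> {within `[c, d], continuous g}.
Proof.
move=> ac db; apply: continuous_subspaceW.
by apply: subset_itv; rewrite bnd_simp.
Qed.

Lemma integrable_normr D h : measurable D ->
  mu.-integrable D (EFin \o h) -> mu.-integrable D (EFin \o (fun s => `|h s|)).
Proof. by move=> mD ih; have := integrable_abse ih. Qed.

Lemma integrable_mulrl D (k : R) h : measurable D ->
  mu.-integrable D (EFin \o h) -> mu.-integrable D (EFin \o (fun s => k * h s)).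
Proof. by move=> mD ih; have := integrableZl mD k ih. Qed.

Lemma integrable_addr D h h' : measurable D ->
  mu.-integrable D (EFin \o h) -> mu.-integrable D (EFin \o h') ->
  mu.-integrable D (EFin \o (fun s => h s + h' s)).
Proof. by move=> mD ih ih'; have := integrableD mD ih ih'. Qed.

Lemma integrable_subr D h h' : measurable D ->
  mu.-integrable D (EFin \o h) -> mu.-integrable D (EFin \o h') ->
  mu.-integrable D (EFin \o (fun s => h s - h' s)).
Proof. by move=> mD ih ih'; have := integrableB mD ih ih'. Qed.

End segment_integral.

Section riemann_stieltjes.
Context {R : realType}.
Implicit Types (a b c : R) (g h F G H : R -> R).
Let mu := @lebesgue_measure R.

Lemma fine_itv_partition a b (delta : R) : a <= b -> 0 < delta ->
  exists2 s, itv_partition a b s & forall i, (i < size s)%N ->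
    nth b (a :: s) i.+1 - nth b (a :: s) i < delta.
Proof.
move=> ab d0; have d20 : 0 < delta / 2 by rewrite divr_gt0.
have [n] : exists n, b - a <= n%:R * (delta / 2).
  exists (Num.bound ((b - a) / (delta / 2))); rewrite -ler_pdivrMr//.
  by rewrite ltW// archi_boundP// divr_ge0 ?subr_ge0// ltW.
elim: n a ab => [|n IH] a; rewrite le_eqVlt.
- move=> + /[!mul0r] ba => /predU1P[->|ab]; first by exists [::] => //; split; rewrite /= ?eqxx.
  by exfalso; lra.
- move=> + ban => /predU1P[->|ab]; first by exists [::] => //; split; rewrite /= ?eqxx.
have [abd|dab] := ltP (b - a) delta.
  exists [:: b]; first exact: itv_partition1.
  by case=> [|i].
have [||s [ps /eqP ls] sd] := IH (a + delta / 2).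
- lra.
- by move: ban; rewrite -natr1; lra.
exists (a + delta / 2 :: s).
  by split => /=; [rewrite ps andbT; lra|rewrite ls].
move=> [_|i /= si]; first by rewrite /=; lra.
exact: sd.
Qed.

(** On each cell of the partition the increment of [H] is an integral of [h], so
the error is the integral of (g (tau i) - g) h. *)
Lemma RS_sum_approx a b g h H (eta : R) (s : seq R) (tau : nat -> R) :
  mu.-integrable `[a, b] (EFin \o h) -> {within `[a, b], continuous g} ->
  (forall c d, a <= c -> c <= d -> d <= b -> H d - H c = (\int[mu]_(r in `[c, d]) h r)%R) ->
  itv_partition a b s ->
  (forall i, (i < size s)%N -> forall r,
    nth b (a :: s) i <= r <= nth b (a :: s) i.+1 -> `|g (tau i) - g r| <= eta) ->
  `|\sum_(i < size s) g (tau i) * (H (nth b (a :: s) i.+1) - H (nth b (a :: s) i))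
    - (\int[mu]_(r in `[a, b]) (g r * h r))%R| <=
  eta * (\int[mu]_(r in `[a, b]) `|h r|)%R.
Proof.
move=> ih cg HE; elim: s a tau ih cg HE => [|c s IH] a tau ih cg HE ps gtau.
  move: ps => /itv_partition_nil ->; rewrite set_itv1 !Rintegral_set1.
  by rewrite big_ord0 mulr0 subrr normr0.
have pcs := itv_partition_cons ps.
have cb : c <= b by exact: itv_partition_le pcs.
have ac : a <= c by case: ps => /= /andP[/ltW].
have igh := integrable_contM cg ih.
rewrite big_ord_recl/= (HE a c)// (Rintegral_itv_cat ac cb igh).
rewrite (Rintegral_itv_cat ac cb (integrable_normr _ ih))//.
have ihac : mu.-integrable `[a, c] (EFin \o h) by exact: integrable_subitv ih.
have ighac : mu.-integrable `[a, c] (EFin \o (fun r => g r * h r)).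
  exact: integrable_subitv igh.
rewrite mulrDr opprD addrACA (le_trans (ler_normD _ _))// lerD//.
  rewrite -RintegralZl// -RintegralB//; last exact: integrable_mulrl.
  rewrite (le_trans (le_normr_Rintegral _ _))//.
    by apply: integrable_subr => //; exact: integrable_mulrl.
  rewrite -RintegralZl//; last exact: integrable_normr.
  apply: le_Rintegral => //.
  - apply: integrable_normr => //; apply: integrable_subr => //.
    exact: integrable_mulrl.
  - by apply: integrable_mulrl => //; exact: integrable_normr.
  move=> r; rewrite /= in_itv/= => acr; rewrite -mulrBl normrM ler_wpM2r//.
  exact: (gtau 0%N).
under eq_bigr do rewrite /bump/= add1n.
apply: (IH c (fun i => tau i.+1)) => //.
- exact: integrable_subitv ih.
- exact: within_continuous_itvS cg.
- by move=> c' d cc'; apply: HE; exact: le_trans cc'.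
- by move=> i si r pr; exact: (gtau i.+1).
Qed.

Lemma is_RSint_primitive a b g h H :
  mu.-integrable `[a, b] (EFin \o h) -> {within `[a, b], continuous g} ->
  (forall c d, a <= c -> c <= d -> d <= b ->
    H d - H c = (\int[mu]_(r in `[c, d]) h r)%R) ->
  is_RSint a b g H (\int[mu]_(r in `[a, b]) (g r * h r))%R.
Proof.
move=> ih cg HE e e0; set N := (\int[mu]_(r in `[a, b]) `|h r|)%R.
have N0 : 0 <= N by exact: Rintegral_ge0.
have N1 : 0 < N + 1 by rewrite ltr_wpDl.
have [d d0 gd] := heine_cantor cg (divr_gt0 e0 N1).
exists d => // s tau ps /= stau.
apply: (@le_lt_trans _ _ (e / (N + 1) * N)); last first.
  by rewrite mulrAC ltr_pdivrMr// ltr_pM2l// ltrDl.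
apply: RS_sum_approx => // i si r pr; apply/ltW/gd.
- have /= [_ /andP[t1 t2]] := stau i si; rewrite in_itv/=.
  rewrite (le_trans _ t1) ?(le_trans t2)//=; first exact: (@itv_partition_nth_le _ _ a b s i.+1).
  by apply: itv_partition_nth_ge => //; exact: ltnW.
- move: pr => /andP[r1 r2]; rewrite in_itv/= (le_trans _ r1) ?(le_trans r2)//=.
    exact: (@itv_partition_nth_le _ _ a b s i.+1).
  by apply: itv_partition_nth_ge => //; exact: ltnW.
- have /= [pd /andP[t1 t2]] := stau i si; move: pr => /andP[r1 r2].
  by move: pd t1 t2 r1 r2 => /=; rewrite ltr_norml; set p := nth _ _ _; set q := nth _ (_ :: _) _;
    move=> *; apply/andP; split; lra.
Qed.

Lemma itv_partition_nthS a b s i : itv_partition a b s -> (i < size s)%N ->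
  nth b (a :: s) i <= nth b (a :: s) i.+1.
Proof.
move=> [+ _] si; rewrite lt_path_pairwise => /(pairwiseP b) pw.
by apply/ltW/pw; rewrite ?inE//= ltnS// ltnW.
Qed.

Lemma is_RSint_unique a b g H v w : a <= b ->
  is_RSint a b g H v -> is_RSint a b g H w -> v = w.
Proof.
move=> ab gv gw; apply/eqP; rewrite -subr_eq0 -normr_le0.
apply/ler_addgt0Pr => e e0; rewrite add0r.
have e20 : 0 < e / 2 by rewrite divr_gt0.
have [d d0 sv] := gv _ e20; have [d' d'0 sw] := gw _ e20.
have [|s ps sd] := @fine_itv_partition a b (Num.min d d') ab; first by rewrite lt_min d0.
have pt i (si : (i < size s)%N) : nth b (a :: s) i <= nth b (a :: s) i <= nth b (a :: s) i.+1.
  by rewrite lexx/=; exact: itv_partition_nthS.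
have := sv s (nth b (a :: s)) ps; have := sw s (nth b (a :: s)) ps.
cbv zeta; move=> /(_ _)/wrap[i si|].
  by split; [have := sd i si; rewrite lt_min => /andP[]|exact: pt].
move=> sw' /(_ _)/wrap[i si|].
  by split; [have := sd i si; rewrite lt_min => /andP[]|exact: pt].
move: sw'; rewrite !ltr_norml => /andP[? ?] /andP[? ?].
by rewrite ler_norml; apply/andP; split; lra.
Qed.

Lemma RSintE a b g H v : a <= b -> is_RSint a b g H v -> RSint a b g H = v.
Proof.
move=> ab gv; rewrite /RSint; case: xgetP => [w -> gw|/(_ v)//].
exact: is_RSint_unique gv.
Qed.

(** Summation by parts: the sums tagged at the right ends for [F dG] and at the
left ends for [G dF] add up to a telescoping sum of [F G]. *)
Lemma is_RSint_by_parts a b F G v w : a <= b ->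
  is_RSint a b F G v -> is_RSint a b G F w -> v + w = F b * G b - F a * G a.
Proof.
move=> ab Fv Gw; apply/eqP; rewrite -subr_eq0 -normr_le0.
apply/ler_addgt0Pr => e e0; rewrite add0r.
have e20 : 0 < e / 2 by rewrite divr_gt0.
have [d d0 sv] := Fv _ e20; have [d' d'0 sw] := Gw _ e20.
have [|s ps sd] := @fine_itv_partition a b (Num.min d d') ab; first by rewrite lt_min d0.
pose pt := nth b (a :: s).
have ptS i : (i < size s)%N -> pt i <= pt i.+1 by exact: itv_partition_nthS.
have := sv s (fun i => pt i.+1) ps; have := sw s pt ps.
cbv zeta; move=> /(_ _)/wrap[i si|].
  split; first by have := sd i si; rewrite lt_min => /andP[].
  by rewrite lexx; exact: ptS.
move=> sw' /(_ _)/wrap[i si|].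
  split; first by have := sd i si; rewrite lt_min => /andP[].
  by rewrite lexx andbT; exact: ptS.
have : \sum_(i < size s) F (pt i.+1) * (G (pt i.+1) - G (pt i)) +
       \sum_(i < size s) G (pt i) * (F (pt i.+1) - F (pt i)) = F b * G b - F a * G a.
  rewrite -big_split/= -[F b * G b](_ : F (pt (size s)) * G (pt (size s)) = _); last first.
    by rewrite /pt (itv_partition_nth_size _ ps).
  rewrite -(@telescope_sumr _ 0 (size s) (fun i => F (pt i) * G (pt i)))//.
  by rewrite big_mkord; apply: eq_bigr => i _; ring.
move: sw'; rewrite -/pt; set S := \sum_(i < _) _; set S' := \sum_(i < _) _.
rewrite !ltr_norml => /andP[? ?] /[swap] /andP[? ?] ?.
by rewrite ler_norml; apply/andP; split; lra.
Qed.

End riemann_stieltjes.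


Section primitives.
Context {R : realType} (T : R).
Implicit Types (t : R) (g h : R -> R).
Let mu := @lebesgue_measure R.
Local Notation integrable h := (mu.-integrable `[0, T] (EFin \o h)).

Lemma Rintegral_itv_increment h c d : integrable h -> 0 <= c -> c <= d -> d <= T ->
  (\int[mu]_(r in `[0, d]) h r)%R - (\int[mu]_(r in `[0%R, c]) h r)%R =
  (\int[mu]_(r in `[c, d]) h r)%R.
Proof.
move=> ih c0 cd dT; rewrite (Rintegral_itv_cat c0 cd); last exact: integrable_subitv ih.
by rewrite addrC addKr.
Qed.

Lemma primitive_within_continuous h : 0 <= T -> integrable h ->
  {within `[0, T], continuous (fun t => \int[mu]_(r in `[0, t]) h r)%R}.
Proof. by move=> T0 ih; exact: parameterized_integral_continuous. Qed.

Lemma ler_Rintegral_itv h t : integrable h -> t \in `[0, T] ->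
  (forall s, s \in `[0, T] -> 0 <= h s) ->
  (\int[mu]_(s in `[0, t]) h s)%R <= (\int[mu]_(s in `[0%R, T]) h s)%R.
Proof.
rewrite in_itv/= => ih /andP[t0 tT] h0; rewrite -subr_ge0 Rintegral_itv_increment//.
apply: Rintegral_ge0 => s /=; rewrite in_itv/= => /andP[ts sT].
by apply: h0; rewrite in_itv/= sT (le_trans t0).
Qed.

Lemma normr_RintegralM_le (B : R) g h t : {within `[0, T], continuous g} ->
  integrable h -> t \in `[0, T] -> 0 <= B ->
  (forall s, s \in `[0, t] -> `|g s| <= B) ->
  `|\int[mu]_(s in `[0, t]) (g s * h s)|%R <=
  B * (\int[mu]_(s in `[0%R, T]) `|h s|)%R.
Proof.
move=> cg ih tT B0 gB; move: (tT); rewrite in_itv/= => /andP[t0 t1].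
have igh := integrable_contM cg ih.
rewrite (le_trans (le_normr_Rintegral _ (integrable_subitv (lexx 0) t1 igh)))//.
rewrite (@le_trans _ _ (\int[mu]_(s in `[0, t]) (B * `|h s|))%R)//.
  apply: le_Rintegral => //.
  - by apply: integrable_normr => //; exact: integrable_subitv igh.
  - apply: integrable_mulrl => //; apply: integrable_normr => //.
    exact: integrable_subitv ih.
  - by move=> s st; rewrite normrM ler_wpM2r// gB.
have inh : integrable (fun s => `|h s|) by exact: integrable_normr.
rewrite RintegralZl//; last exact: integrable_subitv inh.
by rewrite ler_wpM2l// ler_Rintegral_itv.
Qed.

(** Integration by parts for Riemann-Stieltjes integrals, rewritten with densities.
The densities are only integrable, so [H] and [K] may fail to be differentiable. *)
Lemma primitive_product_rule h k t : integrable h -> integrable k -> t \in `[0, T] ->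
  let H s := (\int[mu]_(r in `[0%R, s]) h r)%R in
  let K s := (\int[mu]_(r in `[0%R, s]) k r)%R in
  H t * K t = (\int[mu]_(s in `[0%R, t]) (K s * h s))%R +
              (\int[mu]_(s in `[0%R, t]) (H s * k s))%R.
Proof.
rewrite in_itv/= => ih ik /andP[t0 tT]; cbv zeta.
set H := fun s => (\int[mu]_(r in `[0%R, s]) h r)%R.
set K := fun s => (\int[mu]_(r in `[0%R, s]) k r)%R.
rewrite -/(H t) -/(K t).
have T0 : 0 <= T by exact: le_trans tT.
have cH : {within `[0, t], continuous H}.
  by apply: within_continuous_itvS (primitive_within_continuous T0 ih).
have cK : {within `[0, t], continuous K}.
  by apply: within_continuous_itvS (primitive_within_continuous T0 ik).
have HK : is_RSint 0 t K H (\int[mu]_(s in `[0%R, t]) (K s * h s))%R.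
  apply: is_RSint_primitive => //; first exact: integrable_subitv ih.
  by move=> c d c0 cd dt; rewrite Rintegral_itv_increment// (le_trans dt).
have KH : is_RSint 0 t H K (\int[mu]_(s in `[0%R, t]) (H s * k s))%R.
  apply: is_RSint_primitive => //; first exact: integrable_subitv ik.
  by move=> c d c0 cd dt; rewrite Rintegral_itv_increment// (le_trans dt).
rewrite (is_RSint_by_parts t0 HK KH) /H /K set_itv1 !Rintegral_set1.
by rewrite mul0r subr0 mulrC.
Qed.

End primitives.

(** * Iterated integrals indexed by words *)

Section word_integrals.
Context {R : realType} {I : Type}.
Implicit Types (t : R) (h k : I -> R -> R) (w v : seq I) (s : seq (R * seq I)).
Let mu := @lebesgue_measure R.

(** The head of the word is the letter that is integrated last, over the largest
variable of the simplex. *)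
Fixpoint word_integral h w t : R :=
  if w is a :: w' then (\int[mu]_(s in `[0, t]) (word_integral h w' s * h a s))%R
  else 1.

Definition word_comb h s t : R := \sum_(cw <- s) cw.1 * word_integral h cw.2 t.

Lemma word_comb_cat h s s' t :
  word_comb h (s ++ s') t = word_comb h s t + word_comb h s' t.
Proof. by rewrite /word_comb big_cat. Qed.

Lemma word_comb_cons h cw s t :
  word_comb h (cw :: s) t = cw.1 * word_integral h cw.2 t + word_comb h s t.
Proof. by rewrite /word_comb big_cons. Qed.

Lemma word_combZ h (c : R) s t :
  word_comb h [seq (c * cw.1, cw.2) | cw <- s] t = c * word_comb h s t.
Proof.
rewrite /word_comb big_map mulr_sumr; apply: eq_bigr => cw _ /=.
by rewrite mulrA.
Qed.

Lemma eq_word_integral (P : pred I) h k w t :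
  (forall a, P a -> h a =1 k a) -> all P w ->
  word_integral h w t = word_integral k w t.
Proof.
move=> hk; elim: w t => //= a w IH t /andP[Pa Pw].
by apply: eq_Rintegral => s _; rewrite IH// hk.
Qed.

Lemma eq_word_comb (P : pred I) h k s t :
  (forall a, P a -> h a =1 k a) -> all (fun cw => all P cw.2) s ->
  word_comb h s t = word_comb k s t.
Proof.
move=> hk; rewrite /word_comb; elim: s => [|cw s IH /= /andP[Pc Ps]]; first by rewrite !big_nil.
by rewrite !big_cons IH// (eq_word_integral _ hk).
Qed.

Variables (T : R) (T0 : 0 <= T).
Let dens h := forall a, mu.-integrable `[0, T] (EFin \o h a).

Lemma word_integral_continuous h w : dens h ->
  {within `[0, T], continuous (word_integral h w)}.
Proof.
move=> ih; elim: w => [|a w IH] /=.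
  by apply: continuous_subspaceT => x; exact: cst_continuous.
by apply: primitive_within_continuous => //; exact: integrable_contM.
Qed.

Lemma word_comb_continuous h s : dens h ->
  {within `[0, T], continuous (word_comb h s)}.
Proof.
move=> ih; rewrite /word_comb; elim: s => [|cw s IH].
  under [X in continuous X]eq_fun do rewrite big_nil.
  by apply: continuous_subspaceT => x; exact: cst_continuous.
under [X in continuous X]eq_fun do rewrite big_cons.
apply: within_continuousD => // x; apply: cvgM; first exact: cvg_cst.
exact: word_integral_continuous.
Qed.

Lemma integrable_word_integrand h a w : dens h ->
  mu.-integrable `[0, T] (EFin \o (fun r => word_integral h w r * h a r)).
Proof. by move=> ih; apply: integrable_contM => //; exact: word_integral_continuous. Qed.

Lemma integrable_word_comb_integrand h a s : dens h ->
  mu.-integrable `[0, T] (EFin \o (fun r => word_comb h s r * h a r)).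
Proof. by move=> ih; apply: integrable_contM => //; exact: word_comb_continuous. Qed.

Lemma Rintegral_word_comb h a s t : dens h -> t \in `[0, T] ->
  (\int[mu]_(r in `[0, t]) (word_comb h s r * h a r))%R =
  word_comb h [seq (cw.1, a :: cw.2) | cw <- s] t.
Proof.
move=> ih; rewrite in_itv/= => /andP[t0 tT].
elim: s => [|cw s IH].
  rewrite /word_comb big_nil; under eq_Rintegral do rewrite big_nil mul0r.
  by rewrite Rintegral_cst// mul0r.
rewrite /= word_comb_cons -IH/=.
rewrite -RintegralZl//; last exact: integrable_subitv (integrable_word_integrand _ _ ih).
rewrite -RintegralD//; first last.
- exact: integrable_subitv (integrable_word_comb_integrand _ _ ih).
- by apply: integrable_mulrl => //; exact: integrable_subitv (integrable_word_integrand _ _ ih).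
by apply: eq_Rintegral => r _; rewrite word_comb_cons; ring.
Qed.

(** The shuffle product, in the existential form that makes the combinations of
words an algebra. The product rule for the words [a :: w] and [b :: v] leaves
the products of [w] with [b :: v] and of [a :: w] with [v]. The combination
does not depend on the densities, and its words only use the letters of the
factors; with the single time letter this yields the algebra of polynomials. *)
Theorem word_integral_shuffle (P : pred I) w v : all P w -> all P v ->
  exists2 s, all (fun cw => all P cw.2) s &
    forall h, dens h -> forall t, t \in `[0, T] ->
      word_integral h w t * word_integral h v t = word_comb h s t.
Proof.
elim: w v => [|a w IHw] v.
  move=> _ Pv; exists [:: (1, v)] => [|h _ t _]; first by rewrite /= Pv.
  by rewrite /word_comb big_seq1 mul1r.
elim: v => [|b v IHv] Pw Pv.
  exists [:: (1, a :: w)] => [|h _ t _]; first by rewrite /= andbT.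
  by rewrite /word_comb big_seq1 mul1r mulr1.
have /= /andP[Pa Pw'] := Pw; have /= /andP[Pb Pv'] := Pv.
have [s1 Ps1 s1E] := IHw (b :: v) Pw' Pv.
have [s2 Ps2 s2E] := IHv Pw Pv'.
exists ([seq (cw.1, a :: cw.2) | cw <- s1] ++ [seq (cw.1, b :: cw.2) | cw <- s2]).
  rewrite all_cat !all_map; apply/andP; split.
    by apply: sub_all Ps1 => cw /=; rewrite Pa.
  by apply: sub_all Ps2 => cw /=; rewrite Pb.
move=> h ih t tT; rewrite word_comb_cat -!Rintegral_word_comb//=.
have := @primitive_product_rule _ T _ _ t (integrable_word_integrand a w ih) (integrable_word_integrand b v ih) tT.
move: tT; rewrite in_itv/= => /andP[t0 tT].
move=> /= ->; congr (_ + _); apply: eq_Rintegral => r; rewrite inE/= in_itv/= => /andP[r0 rt].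
  by rewrite mulrA -s1E ?in_itv/= ?r0 ?(le_trans rt)//; congr (_ * _); rewrite mulrC.
by rewrite mulrA -s2E ?in_itv/= ?r0 ?(le_trans rt).
Qed.

Lemma word_comb_mul (P : pred I) s s' :
  all (fun cw => all P cw.2) s -> all (fun cw => all P cw.2) s' ->
  exists2 s'', all (fun cw => all P cw.2) s'' &
    forall h, dens h -> forall t, t \in `[0, T] ->
      word_comb h s t * word_comb h s' t = word_comb h s'' t.
Proof.
elim: s => [|[c w] s IH] /=.
  by exists [::] => // h _ t _; rewrite /word_comb !big_nil mul0r.
move=> /andP[Pw Ps] Ps'; have [s1 Ps1 s1E] := IH Ps Ps'.
have [s2 Ps2 s2E] : exists2 s2, all (fun cw => all P cw.2) s2 &
    forall h, dens h -> forall t, t \in `[0, T] ->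
      word_integral h w t * word_comb h s' t = word_comb h s2 t.
  elim: s' Ps' {s IH Ps s1 Ps1 s1E} => [|[d v] s' IH] /=.
    by exists [::] => // h _ t _; rewrite /word_comb !big_nil mulr0.
  move=> /andP[Pv /IH[s2 Ps2 s2E]]; have [s3 Ps3 s3E] := word_integral_shuffle Pw Pv.
  exists ([seq (d * cw.1, cw.2) | cw <- s3] ++ s2).
    by rewrite all_cat Ps2 andbT all_map; exact: sub_all Ps3.
  move=> h ih t tT; rewrite word_comb_cat word_combZ -s2E// -s3E//.
  by rewrite word_comb_cons/=; ring.
exists ([seq (c * cw.1, cw.2) | cw <- s2] ++ s1).
  by rewrite all_cat Ps1 andbT all_map; exact: sub_all Ps2.
move=> h ih t tT; rewrite word_comb_cat word_combZ -s1E// -s2E//.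
by rewrite word_comb_cons/=; ring.
Qed.

Lemma within_continuous_bounded (g : R -> R) : {within `[0, T], continuous g} ->
  exists2 B : R, 0 < B & forall t, t \in `[0, T] -> `|g t| <= B.
Proof.
move=> cg; have := compact_bounded (continuous_compact cg (@segment_compact _ 0 T)).
case=> M [Mreal gM]; exists (`|M| + 1); first by rewrite ltr_wpDl.
move=> t tT; apply: (gM (`|M| + 1)); last by exists t.
by rewrite (le_lt_trans (ler_norm _))// ltrDl.
Qed.

(** Along a word the perturbation propagates as
W h_a - W' k_a = W (h_a - k_a) + (W - W') k_a. *)
Lemma word_integral_stable h w : dens h -> forall e : R, 0 < e ->
  exists2 delta : R, 0 < delta & forall k, dens k ->
    (forall a, (\int[mu]_(r in `[0, T]) `|h a r - k a r|)%R < delta) ->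
    forall t, t \in `[0, T] -> `|word_integral h w t - word_integral k w t| < e.
Proof.
move=> ih; elim: w => [|a w IH] e e0.
  by exists 1 => // k _ _ t _; rewrite subrr normr0.
have cw := @word_integral_continuous h w ih.
have [B B0 hB] := within_continuous_bounded cw.
set N := (\int[mu]_(r in `[0, T]) `|h a r|)%R.
have N0 : 0 <= N by exact: Rintegral_ge0.
have N1 : 0 < N + 1 by rewrite ltr_wpDl.
have e20 : 0 < e / 2 by rewrite divr_gt0.
have [d d0 dP] := IH _ (divr_gt0 e20 N1).
exists (Num.min (Num.min d 1) (e / 2 / B)).
  by rewrite !lt_min d0 ltr01 divr_gt0.
move=> k ik hk t tT /=.
have hkd b : (\int[mu]_(r in `[0, T]) `|h b r - k b r|)%R < d.
  by have := hk b; rewrite !lt_min => /andP[/andP[]].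
have := hk a; rewrite !lt_min => /andP[/andP[_ hk1 hk2]].
have ihk : mu.-integrable `[0, T] (EFin \o (fun r => h a r - k a r)).
  exact: integrable_subr.
have /andP[t0 t1] : 0 <= t <= T by move: tT; rewrite in_itv.
have -> : (\int[mu]_(r in `[0, t]) (word_integral h w r * h a r))%R -
    (\int[mu]_(r in `[0, t]) (word_integral k w r * k a r))%R =
  (\int[mu]_(r in `[0, t]) (word_integral h w r * (h a r - k a r)))%R +
  (\int[mu]_(r in `[0, t]) ((word_integral h w r - word_integral k w r) * k a r))%R.
  rewrite -RintegralD//; first last.
  - apply: integrable_subitv (lexx 0) t1 _; apply: integrable_contM => //.
    by apply: within_continuousB => //; exact: word_integral_continuous.
  - by apply: integrable_subitv (lexx 0) t1 _; exact: integrable_contM.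
  rewrite -RintegralB//; first last.
  - exact: integrable_subitv (lexx 0) t1 (integrable_word_integrand _ _ ik).
  - exact: integrable_subitv (lexx 0) t1 (integrable_word_integrand _ _ ih).
  by apply: eq_Rintegral => r _; ring.
rewrite (le_lt_trans (ler_normD _ _))// (splitr e) ltr_leD//.
  apply: le_lt_trans (normr_RintegralM_le cw ihk tT (ltW B0) _) _.
    move=> r; rewrite in_itv/= => /andP[s0 st]; apply: hB.
    by rewrite in_itv/= s0 (le_trans st).
  by rewrite mulrC -ltr_pdivlMr.
have /le_trans : `|\int[mu]_(r in `[0, t])
    ((word_integral h w r - word_integral k w r) * k a r)|%R <=
    e / 2 / (N + 1) * (\int[mu]_(r in `[0%R, T]) `|k a r|)%R.
  apply: normr_RintegralM_le => //.
  - by apply: within_continuousB => //; exact: word_integral_continuous.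
  - by rewrite ltW// divr_gt0.
  - move=> r; rewrite in_itv/= => /andP[s0 st]; apply/ltW/dP => //.
    by rewrite in_itv/= s0 (le_trans st).
apply; rewrite mulrAC ler_pdivrMr// ler_pM2l//.
apply: (@le_trans _ _ (\int[mu]_(r in `[0, T]) (`|h a r| + `|h a r - k a r|))%R).
  apply: le_Rintegral => //; first exact: integrable_normr.
    by apply: integrable_addr => //; exact: integrable_normr.
  move=> r _; rewrite -[in leLHS](subKr (h a r) (k a r)).
  exact: ler_normB.
by rewrite RintegralD// ?lerD2l ?ltW//; exact: integrable_normr.
Qed.

End word_integrals.


(** * Gronwall's inequality with an integrable kernel *)

Section gronwall.
Context {R : realType}.
Implicit Types (phi k : R -> R) (t T alpha : R).
Let mu := @lebesgue_measure R.

Lemma expR_convex (x y : R) : expR x * (y - x) <= expR y - expR x.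
Proof.
have := expR_ge1Dx (y - x); rewrite -(ler_pM2l (expR_gt0 x)) -expRD.
by rewrite [x + _]addrC subrK mulrDr mulr1; lra.
Qed.

Lemma exp_primitive_continuous T (c : R) k : 0 <= T ->
  mu.-integrable `[0, T] (EFin \o k) ->
  {within `[0, T], continuous (fun t => expR (c * \int[mu]_(s in `[0, t]) k s))%R}.
Proof.
move=> T0 ik; apply: (@within_continuous_comp _ _ _ `[0, T]%classic
    (fun t => c * \int[mu]_(s in `[0, t]) k s)%R expR).
  by move=> x _; exact: continuous_expR.
move=> x; apply: cvgM; first exact: cvg_cst.
exact: primitive_within_continuous.
Qed.

(** This replaces the chain rule for exp (2 K): by convexity of the exponential,
each term of a Riemann-Stieltjes sum tagged at left ends is at most half of the
increment of exp (2 K). *)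
Lemma Rintegral_exp_le T k t : mu.-integrable `[0, T] (EFin \o k) ->
  t \in `[0, T] ->
  (\int[mu]_(s in `[0, t]) (expR (2 * (\int[mu]_(r in `[0%R, s]) k r)) * k s))%R <=
  (expR (2 * (\int[mu]_(r in `[0%R, t]) k r)%R) - 1) / 2.
Proof.
move=> ik; rewrite in_itv/= => /andP[t0 tT].
have T0 : 0 <= T by exact: le_trans tT.
set K := fun s => (\int[mu]_(r in `[0%R, s]) k r)%R; rewrite -/(K t).
have RS : is_RSint 0 t (fun s => expR (2 * K s)) K
    (\int[mu]_(s in `[0%R, t]) (expR (2 * K s) * k s))%R.
  apply: is_RSint_primitive.
  - exact: integrable_subitv ik.
  - by apply: (within_continuous_itvS (lexx 0) tT); exact: exp_primitive_continuous.
  - by move=> c d c0 cd dt; rewrite (Rintegral_itv_increment ik)// (le_trans dt).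
apply/ler_addgt0Pr => e e0; have [d d0 RSd] := RS _ e0.
have [s ps sd] := fine_itv_partition t0 d0.
pose pt := nth t (0 :: s).
have /= := RSd s pt ps; rewrite -/pt => /(_ _)/wrap[i si|].
  by split; [exact: sd|rewrite lexx; exact: itv_partition_nthS].
have : \sum_(i < size s) expR (2 * K (pt i)) * (K (pt i.+1) - K (pt i)) <=
    (expR (2 * K t) - 1) / 2.
  have -> : expR (2 * K t) - 1 =
      expR (2 * K (pt (size s))) - expR (2 * K (pt 0%N)).
    rewrite {1}/pt (itv_partition_nth_size _ ps) (_ : pt 0%N = 0)//.
    by rewrite (_ : K 0 = 0) ?mulr0 ?expR0// /K set_itv1 Rintegral_set1.
  rewrite -(@telescope_sumr _ 0 (size s) (fun i => expR (2 * K (pt i))))//.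
  rewrite big_mkord mulr_suml; apply: ler_sum => i _.
  rewrite ler_pdivlMr// -mulrA (mulrC _ 2) mulrBr; exact: expR_convex.
by rewrite ltr_norml => S1 /andP[S2 S3]; lra.
Qed.

(** Let S be the maximum of phi exp (- 2 K). At the point where it is reached the
inequality gives S <= alpha + S / 2 by [Rintegral_exp_le], hence S <= 2 alpha. *)
Lemma gronwall T alpha phi k : 0 <= T ->
  mu.-integrable `[0, T] (EFin \o k) -> (forall s, s \in `[0, T] -> 0 <= k s) ->
  {within `[0, T], continuous phi} -> (forall s, s \in `[0, T] -> 0 <= phi s) ->
  (forall t, t \in `[0, T] ->
    phi t <= alpha + (\int[mu]_(s in `[0, t]) (phi s * k s))%R) ->
  forall t, t \in `[0, T] ->
    phi t <= 2 * alpha * expR (2 * (\int[mu]_(s in `[0, T]) k s)%R).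
Proof.
move=> T0 ik k0 cphi phi0 phile.
have T00 : 0 \in `[0, T] by rewrite in_itv/= lexx.
have alpha0 : 0 <= alpha.
  by have := phile 0 T00; rewrite set_itv1 Rintegral_set1 addr0; apply: le_trans; exact: phi0.
pose K s := (\int[mu]_(r in `[0%R, s]) k r)%R.
pose psi s := phi s * expR (- 2 * K s).
have cpsi : {within `[0, T], continuous psi}.
  have cE : {within `[0, T], continuous (fun s => expR (- 2 * K s))}.
    exact: exp_primitive_continuous.
  by move=> x; apply: cvgM; [exact: cphi|exact: cE].
have [c c0T psic] := EVT_max T0 cpsi.
have K0 s : s \in `[0, T] -> 0 <= K s.
  rewrite in_itv/= => /andP[s0 sT]; apply: Rintegral_ge0 => r /=.
  by rewrite in_itv/= => /andP[r0 rs]; rewrite k0// in_itv/= r0 (le_trans rs).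
have phiE s : phi s = psi s * expR (2 * K s).
  by rewrite /psi -mulrA -expRD -mulrDl addNr mul0r expR0 mulr1.
have psi0 s : s \in `[0, T] -> 0 <= psi s.
  by move=> sT; rewrite mulr_ge0 ?phi0// ltW// expR_gt0.
have S2 : psi c <= 2 * alpha.
  have /andP[c0 cT] : 0 <= c <= T by move: c0T; rewrite in_itv.
  have ciK : {within `[0, c], continuous (fun s => expR (2 * K s))}.
    by apply: (within_continuous_itvS (lexx 0) cT); exact: exp_primitive_continuous.
  have ikc : mu.-integrable `[0, c] (EFin \o k) by exact: integrable_subitv ik.
  have : (\int[mu]_(s in `[0%R, c]) (phi s * k s))%R <=
         psi c * ((expR (2 * K c) - 1) / 2).
    apply: (@le_trans _ _ (\int[mu]_(s in `[0%R, c]) (psi c * (expR (2 * K s) * k s)))%R).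
      apply: le_Rintegral => //.
      - by apply: integrable_contM => //; exact: within_continuous_itvS cphi.
      - by apply: integrable_mulrl => //; exact: integrable_contM.
      - move=> s /=; rewrite in_itv/= => /andP[s0 sc].
        have sT : s \in `[0, T] by rewrite in_itv/= s0 (le_trans sc).
        by rewrite mulrA ler_wpM2r ?k0// phiE ler_wpM2r ?psic// ltW// expR_gt0.
    rewrite RintegralZl//; last exact: integrable_contM.
    by rewrite ler_wpM2l ?psi0// (Rintegral_exp_le ik).
  have := phile c c0T; rewrite phiE.
  have : 1 <= expR (2 * K c) by rewrite -expR0 ler_expR mulr_ge0// K0.
  have := psi0 c c0T; move: alpha0.
  set S := psi c; set E := expR _; set J := (\int[mu]_(s in _) _)%R.
  move=> a0 S0 E1 h1 h2.
  have : S * E <= 2 * alpha - S by lra.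
  by nra.
move=> t tT; rewrite phiE.
apply: (@le_trans _ _ (2 * alpha * expR (2 * K t))).
  by rewrite ler_wpM2r ?(ltW (expR_gt0 _))// (le_trans (psic _ tT)).
rewrite ler_wpM2l ?mulr_ge0// ler_expR ler_pM2l//.
exact: ler_Rintegral_itv.
Qed.

Lemma first_exit T phi : {within `[0, T], continuous phi} -> phi 0 <= 1 ->
  (exists2 t, t \in `[0, T] & 1 < phi t) ->
  exists2 t, t \in `[0, T] & phi t = 1 /\ forall s, s \in `[0, t] -> phi s <= 1.
Proof.
move=> /within_continuous_near cphi phi0 [t1 t1T phit1].
pose A := [set t | t \in `[0, T] /\ 1 < phi t].
have A0 : A !=set0 by exists t1.
have lbA : lbound A 0 by move=> t [+ _]; rewrite in_itv/= => /andP[].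
have hlA : has_inf A by split => //; exists 0.
pose tau := inf A.
have tau0 : 0 <= tau by exact: lb_le_inf.
have tauT : tau <= T.
  apply: (@le_trans _ _ t1); last by move: t1T; rewrite in_itv => /andP[].
  by apply: ge_inf => //; [exact: hlA.2].
have tauI : tau \in `[0, T] by rewrite in_itv/= tau0.
have below s : s \in `[0, T] -> s < tau -> phi s <= 1.
  move=> sT stau; rewrite leNgt; apply/negP => phis.
  by move: stau; rewrite ltNge => /negP; apply; apply: ge_inf => //; exact: hlA.2.
have phitau : phi tau = 1.
  apply/eqP; rewrite eq_le; apply/andP; split; rewrite leNgt; apply/negP => phitau.
    have [tau00|taup] := eqVneq tau 0; first by move: phitau; rewrite tau00 ltNge phi0.
    have e0 : 0 < phi tau - 1 by rewrite subr_gt0.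
    have /nbhs_ballP[d /= d0 near] := cphi tau tauI _ e0.
    have taugt0 : 0 < tau by rewrite lt_neqAle eq_sym taup.
    pose s := Num.max 0 (tau - d / 2).
    have d20 : 0 < d / 2 by rewrite divr_gt0.
    have stau : s < tau by rewrite gt_max taugt0/=; lra.
    have sI : s \in `[0, T].
      by rewrite in_itv/= le_max lexx/= (le_trans (ltW stau)).
    have : `|phi tau - phi s| < phi tau - 1.
      apply: near => //; rewrite /ball/= ger0_norm ?subr_ge0 ?(ltW stau)//.
      have : tau - d / 2 <= s by rewrite le_max lexx orbT.
      by lra.
    have := below s sI stau; rewrite ltr_norml => ? /andP[? ?]; lra.
  have e0 : 0 < 1 - phi tau by rewrite subr_gt0.
  have /nbhs_ballP[d /= d0 near] := cphi tau tauI _ e0.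
  have : tau + d <= tau.
    apply: lb_le_inf => // s [sI phis]; rewrite leNgt; apply/negP => sd.
    have taus : tau <= s by apply: ge_inf => //; exact: hlA.2.
    have : `|phi tau - phi s| < 1 - phi tau.
      apply: near => //; rewrite /ball/= distrC ger0_norm ?subr_ge0//.
      by rewrite ltrBlDl.
    by rewrite ltr_norml => /andP[? ?]; lra.
  by rewrite gerDl leNgt d0.
exists tau => //; split => // s; rewrite in_itv/= => /andP[s0].
rewrite le_eqVlt => /predU1P[->|stau]; first by rewrite phitau.
by apply: below => //; rewrite in_itv/= s0 (le_trans (ltW stau)).
Qed.

(** If [phi] exceeded 1, then at its first exit time the bound of [gronwall] would
still apply and be smaller than 1. *)
Lemma gronwall_local T alpha phi k : 0 <= T ->
  mu.-integrable `[0, T] (EFin \o k) -> (forall s, s \in `[0, T] -> 0 <= k s) ->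
  {within `[0, T], continuous phi} -> (forall s, s \in `[0, T] -> 0 <= phi s) ->
  phi 0 <= 1 ->
  (forall t, t \in `[0, T] -> (forall s, s \in `[0, t] -> phi s <= 1) ->
    phi t <= alpha + (\int[mu]_(s in `[0, t]) (phi s * k s))%R) ->
  0 <= alpha ->
  2 * alpha * expR (2 * (\int[mu]_(s in `[0, T]) k s)%R) < 1 ->
  forall t, t \in `[0, T] ->
    phi t <= 2 * alpha * expR (2 * (\int[mu]_(s in `[0, T]) k s)%R).
Proof.
move=> T0 ik k0 cphi phi0 phi01 phile alpha0 small.
have main t : t \in `[0, T] -> (forall s, s \in `[0, t] -> phi s <= 1) ->
    forall s, s \in `[0, t] -> phi s <=
    2 * alpha * expR (2 * (\int[mu]_(s in `[0, T]) k s)%R).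
  move=> tT phi1 s st; move: (tT); rewrite in_itv/= => /andP[t0 tT'].
  have sub r : r \in `[0, t] -> r \in `[0, T].
    by rewrite !in_itv/= => /andP[-> rt]; exact: le_trans tT'.
  apply: (@le_trans _ _ (2 * alpha * expR (2 * (\int[mu]_(s in `[0, t]) k s)%R))).
    apply: (@gronwall t alpha phi k) => //.
    - exact: integrable_subitv ik.
    - by move=> r /sub; exact: k0.
    - exact: within_continuous_itvS cphi.
    - by move=> r /sub; exact: phi0.
    - move=> r rt; apply: phile; first exact: sub.
      move=> q; rewrite in_itv/= => /andP[q0 qr]; apply: phi1.
      by move: rt; rewrite !in_itv/= q0 => /andP[_]; exact: le_trans.
  rewrite ler_wpM2l ?mulr_ge0// ler_expR ler_pM2l//.
  exact: ler_Rintegral_itv.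
have le1 t : t \in `[0, T] -> phi t <= 1.
  move=> tT; rewrite leNgt; apply/negP => phit.
  have [tau tauT [phitau phi1]] := first_exit cphi phi01 (ex_intro2 _ _ t tT phit).
  have : phi tau < 1.
    apply: le_lt_trans small; apply: main phi1 _ _ => //.
    by move: tauT; rewrite !in_itv/= lexx andbT => /andP[].
  by rewrite phitau ltxx.
move=> t tT; apply: (main T) => //.
by rewrite in_itv/= lexx T0.
Qed.

End gronwall.


(** * Stability of the controlled equation *)

Section euclidean_norm.
Context {R : realType} {a b : nat}.
Implicit Types A : 'M[R]_(a, b).

Lemma normr_le_enorm A i j : `|A i j| <= enorm A.
Proof.
rewrite -(@ler_pXn2r _ 2)// ?nnegrE ?enorm_ge0// real_normK ?num_real//.
rewrite enorm_sqr (bigD1 i)//= (bigD1 j)//= -addrA lerDl addr_ge0//.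
  by apply: sumr_ge0 => ? _; exact: sqr_ge0.
by do 2 (apply: sumr_ge0 => ? _); exact: sqr_ge0.
Qed.

End euclidean_norm.

Lemma enorm_cV_le (R : realType) (n : nat) (z : 'cV[R]_n) :
  enorm z <= \sum_i `|z i 0|.
Proof.
apply: le_trans (ler_enorm_sum z) _.
by apply: ler_sum => i _; rewrite big_ord1.
Qed.

Section Rintegral_sum.
Context {R : realType}.
Let mu := @lebesgue_measure R.

Lemma integrable_sumr (D : set R) (n : nat) (F : 'I_n -> R -> R) : measurable D ->
  (forall j, mu.-integrable D (EFin \o F j)) ->
  mu.-integrable D (EFin \o (fun s => \sum_j F j s)).
Proof.
move=> mD iF.
rewrite (_ : _ \o _ = (fun s => \sum_(j < n) (EFin \o F j) s)%E).
  by apply: integrable_sum => //.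
by apply/funext => s; rewrite /= sumEFin.
Qed.

Lemma Rintegral_sum (D : set R) (n : nat) (F : 'I_n -> R -> R) : measurable D ->
  (forall j, mu.-integrable D (EFin \o F j)) ->
  (\int[mu]_(s in D) (\sum_j F j s) = \sum_j \int[mu]_(s in D) F j s)%R.
Proof.
move=> mD; elim: n F => [|n IH] F iF.
  under eq_Rintegral do rewrite big_ord0.
  by rewrite Rintegral_cst// mul0r big_ord0.
rewrite big_ord_recl -IH; last by move=> j; exact: iF.
under eq_Rintegral do rewrite big_ord_recl.
rewrite RintegralD//.
by apply: integrable_sumr => // j; exact: iF.
Qed.

End Rintegral_sum.

Lemma within_continuous_sum_norm (R : realType) (A : set R) (n : nat)
    (F : 'I_n -> R -> R) : (forall i, {within A, continuous (F i)}) ->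
  {within A, continuous (fun t => \sum_i `|F i t|)}.
Proof.
move=> cF t; apply: cvg_big => [|i _]; first exact: add_continuous.
by apply: cvg_norm; exact: cF.
Qed.

Section controlled_equation.
Context {R : realType} (T : R) (d m : nat) (x0 : 'cV[R]_d)
  (f0 : 'cV[R]_d -> 'cV[R]_d) (f : 'cV[R]_d -> 'M[R]_(d, m)).
Hypotheses (T0 : 0 <= T) (hf0 : locally_lipschitz f0) (hf : locally_lipschitz f).
Let mu := @lebesgue_measure R.
Implicit Types (u v : 'I_m -> R -> R) (x y z : R -> 'cV[R]_d) (t : R).
Let dens u := forall j, mu.-integrable `[0, T] (EFin \o u j).

Definition controlled_rhs u x (i : 'I_d) (s : R) : R :=
  f0 (x s) i 0 + \sum_j f (x s) i j * u j s.

(** The integral equation by coordinates, for arbitrary densities in place of a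
square integrable control; absolute continuity follows from the equation. *)
Definition controlled_solution u x : Prop := forall t, t \in `[0, T] -> forall i,
  mu.-integrable `[0, t] (EFin \o controlled_rhs u x i) /\
  x t i 0 = x0 i 0 + (\int[mu]_(s in `[0%R, t]) controlled_rhs u x i s)%R.

Lemma controlled_solution_continuous u x i : controlled_solution u x ->
  {within `[0, T], continuous (fun t => x t i 0)}.
Proof.
move=> sx; have TT : T \in `[0, T] by rewrite in_itv/= T0 lexx.
have cP := primitive_within_continuous T0 (sx T TT i).1.
have : {within `[0, T], continuous
    (fun t => x0 i 0 + (\int[mu]_(s in `[0%R, t]) controlled_rhs u x i s)%R)}.
  by move=> t; apply: cvgD; [exact: cvg_cst|exact: cP].
by apply: subspace_eq_continuous => t; rewrite inE/= => tT; exact/esym/(sx t tT i).2.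
Qed.

Lemma controlled_solution0 u x : controlled_solution u x -> x 0 = x0.
Proof.
move=> sx; apply/matrixP => i j; rewrite ord1 (sx 0 _ i).2 ?in_itv/= ?lexx//.
by rewrite set_itv1 Rintegral_set1 addr0.
Qed.

Definition dist1 x y t : R := \sum_i `|x t i 0 - y t i 0|.

Lemma enorm_dist1 x y t : enorm (x t - y t) <= dist1 x y t.
Proof.
by apply: le_trans (enorm_cV_le _) _; apply: ler_sum => i _; rewrite !mxE.
Qed.

Lemma dist1_continuous u v x y : controlled_solution u x -> controlled_solution v y ->
  {within `[0, T], continuous (dist1 x y)}.
Proof.
move=> sx sy; apply: within_continuous_sum_norm => i.
have cx := controlled_solution_continuous (i := i) sx.
have cy := controlled_solution_continuous (i := i) sy.
by apply: within_continuousB; [exact: cx|exact: cy].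
Qed.

Lemma lipschitz_bound (n k : nat) (g : 'cV[R]_d -> 'M[R]_(n, k)) :
  locally_lipschitz g -> forall r, 0 < r ->
  exists2 M : R, 0 < M & forall p, enorm p <= r -> enorm (g p) <= M.
Proof.
move=> lg r r0; have [L L0 gL] := lg r r0.
exists (L * r + enorm (g 0) + 1).
  by rewrite ltr_wpDl// addr_ge0 ?enorm_ge0// mulr_ge0// ltW.
move=> p pr; rewrite -[g p](subrK (g 0)) (le_trans (ler_enormD _ _))//.
rewrite -addrA lerD//; last by rewrite lerDl.
apply: le_trans (gL p 0 pr _) _; first by rewrite enorm0 ltW.
by rewrite subr0 ler_pM2l.
Qed.

Lemma controlled_solution_bounded u x : controlled_solution u x ->
  exists2 r : R, 0 < r & forall t, t \in `[0, T] -> enorm (x t) <= r.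
Proof.
move=> sx; pose g t := \sum_i `|x t i 0|.
have cg : {within `[0, T], continuous g}.
  apply: within_continuous_sum_norm => i; exact: controlled_solution_continuous sx.
have [B B0 gB] := within_continuous_bounded cg.
exists B => // t tT; rewrite (le_trans (enorm_cV_le _))//.
by rewrite (le_trans (ler_norm _))// gB.
Qed.

(** Splitting f (x) u - f (y) v as (f (x) - f (y)) u + f (y) (u - v) puts only the
reference control [u] into the kernel of Gronwall's inequality, so that the
constant [C] serves for all [v]. The horizon [tau] is free because uniqueness
needs the estimate on [0, tau] alone. *)
Theorem controlled_solution_stable u x : dens u -> controlled_solution u x ->
  exists2 C : R, 0 < C & forall v y, dens v -> controlled_solution v y ->
    forall tau, tau \in `[0, T] ->
    let D := \sum_j (\int[mu]_(s in `[0, tau]) `|u j s - v j s|)%R in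
    C * D < 1 -> forall t, t \in `[0, tau] -> dist1 x y t <= C * D.
Proof.
(* the Lipschitz constants are taken on the unit tube around x *)
move=> iu sx; have [r r0 xr] := controlled_solution_bounded sx.
have r1 : 0 < r + 1 by rewrite ltr_wpDl// ltW.
have [L0 L00 f0L] := hf0 r1; have [L1 L10 fL] := hf r1.
have [M M0 fM] := lipschitz_bound hf r1.
pose k s := d%:R * (L0 + L1 * \sum_j `|u j s|).
have ink b : mu.-integrable `[0, b] (EFin \o cst L0).
  by apply: continuous_compact_integrable; [exact: segment_compact|
    apply: continuous_subspaceT => ?; exact: cst_continuous].
have inU : mu.-integrable `[0, T] (EFin \o (fun s => \sum_j `|u j s|)).
  by apply: integrable_sumr => // j; exact: integrable_normr.
have ik : mu.-integrable `[0, T] (EFin \o k).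
  by apply: integrable_mulrl => //; apply: integrable_addr => //; exact: integrable_mulrl.
have k0 s : 0 <= k s.
  by rewrite mulr_ge0// addr_ge0 ?(ltW L00)// mulr_ge0 ?(ltW L10)// sumr_ge0.
set E := expR (2 * (\int[mu]_(s in `[0, T]) k s)%R).
have E0 : 0 < E by exact: expR_gt0.
exists (2 * (d.+1%:R * M) * E).
  (* d + 1 instead of d keeps the constant positive in dimension 0 *)
  by rewrite !mulr_gt0// ltr0n.
move=> v y iv sy tau tauT D small.
have /andP[tau0 tauT'] : 0 <= tau <= T by move: tauT; rewrite in_itv.
have sub t : t \in `[0, tau] -> t \in `[0, T].
  by rewrite !in_itv/= => /andP[-> /le_trans]; exact.
have D0 : 0 <= D by apply: sumr_ge0 => j _; exact: Rintegral_ge0.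
pose alpha := d.+1%:R * M * D.
have alpha0 : 0 <= alpha by rewrite !mulr_ge0// ltW.
have CD : 2 * (d.+1%:R * M) * E * D = 2 * alpha * E by rewrite /alpha; ring.
rewrite CD in small *.
have Etau : expR (2 * (\int[mu]_(s in `[0, tau]) k s)%R) <= E.
  by rewrite ler_expR ler_pM2l// ler_Rintegral_itv.
have Ele : 2 * alpha * expR (2 * (\int[mu]_(s in `[0, tau]) k s)%R) <= 2 * alpha * E.
  by rewrite ler_wpM2l// mulr_ge0.
pose phi := dist1 x y.
have cphiT : {within `[0, T], continuous phi} by exact: dist1_continuous sx sy.
have cphi : {within `[0, tau], continuous phi} by exact: within_continuous_itvS cphiT.
have phi0 s : 0 <= phi s by exact: sumr_ge0.
have iktau : mu.-integrable `[0, tau] (EFin \o k) by exact: integrable_subitv ik.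
suff main t : t \in `[0, tau] -> (forall s, s \in `[0, t] -> phi s <= 1) ->
    phi t <= alpha + (\int[mu]_(s in `[0, t]) (phi s * k s))%R.
  move=> t tt; apply: (le_trans _ Ele).
  apply: (@gronwall_local R tau alpha phi k) => //.
  - rewrite /phi /dist1 big1 ?ler01// => i _.
    by rewrite (controlled_solution0 sx) (controlled_solution0 sy) subrr normr0.
  - exact: le_lt_trans Ele small.
move=> tt phi1.
have /andP[t0 ttau] : 0 <= t <= tau by move: tt; rewrite in_itv.
have tT : t <= T by exact: le_trans tauT'.
have iut j : mu.-integrable `[0, t] (EFin \o u j) by exact: integrable_subitv (iu j).
have ivt j : mu.-integrable `[0, t] (EFin \o v j) by exact: integrable_subitv (iv j).
have iuvt j : mu.-integrable `[0, t] (EFin \o (fun s => `|u j s - v j s|)).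
  by apply: integrable_normr => //; exact: integrable_subr.
have iD : mu.-integrable `[0, t] (EFin \o (fun s => \sum_j `|u j s - v j s|)).
  exact: integrable_sumr.
have iphik : mu.-integrable `[0, t] (EFin \o (fun s => phi s * k s)).
  apply: integrable_contM; first exact: within_continuous_itvS cphi.
  exact: integrable_subitv ik.
have pointwise i s : s \in `[0, t] ->
    `|controlled_rhs u x i s - controlled_rhs v y i s| <=
    phi s * (L0 + L1 * \sum_j `|u j s|) + M * \sum_j `|u j s - v j s|.
  move=> st; have sT : s \in `[0, T].
    by move: st; rewrite !in_itv/= => /andP[-> /le_trans]; exact.
  have xs : enorm (x s) <= r + 1 by rewrite (le_trans (xr s sT))// lerDl.
  have yxs : enorm (x s - y s) <= phi s by exact: enorm_dist1.
  have ys : enorm (y s) <= r + 1.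
    rewrite (_ : y s = x s + - (x s - y s)); last by rewrite opprB addrC subrK.
    rewrite (le_trans (ler_enormD _ _))// lerD ?xr//.
    by rewrite enormN (le_trans yxs)// phi1.
  have -> : controlled_rhs u x i s - controlled_rhs v y i s =
      (f0 (x s) i 0 - f0 (y s) i 0) + (\sum_j (f (x s) i j - f (y s) i j) * u j s
      + \sum_j f (y s) i j * (u j s - v j s)).
    rewrite /controlled_rhs -big_split/= opprD addrACA; congr (_ + _).
    by rewrite -sumrB; apply: eq_bigr => j _; ring.
  rewrite (le_trans (ler_normD _ _))// mulrDr -addrA lerD//.
    have := normr_le_enorm (f0 (x s) - f0 (y s)) i 0; rewrite !mxE => /le_trans; apply.
    rewrite (le_trans (f0L _ _ xs ys))// mulrC ler_wpM2r// ltW//.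
  rewrite (le_trans (ler_normD _ _))// lerD//.
    rewrite mulrA mulr_sumr (le_trans (ler_norm_sum _ _ _))// ler_sum// => j _.
    rewrite normrM ler_wpM2r//.
    have := normr_le_enorm (f (x s) - f (y s)) i j; rewrite !mxE => /le_trans; apply.
    by rewrite (le_trans (fL _ _ xs ys))// mulrC ler_wpM2r// ltW.
  rewrite mulr_sumr (le_trans (ler_norm_sum _ _ _))// ler_sum// => j _.
  by rewrite normrM ler_wpM2r// (le_trans (normr_le_enorm _ _ _))// fM.
set J := (\int[mu]_(s in `[0, t]) (phi s * (L0 + L1 * \sum_j `|u j s|)))%R.
have tT' : t \in `[0, T] by exact: sub.
have iphik' : mu.-integrable `[0, t]
    (EFin \o (fun s => phi s * (L0 + L1 * \sum_j `|u j s|))).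
  apply: integrable_contM; first exact: within_continuous_itvS cphi.
  apply: integrable_subitv (lexx 0) tT _.
  by apply: integrable_addr => //; exact: integrable_mulrl.
have step i : `|x t i 0 - y t i 0| <= J + M * D.
  have [ix ->] := sx t tT' i; have [iy ->] := sy t tT' i.
  rewrite opprD addrACA subrr add0r -RintegralB//.
  rewrite (le_trans (le_normr_Rintegral _ _))//; first exact: integrable_subr.
  apply: (@le_trans _ _ (\int[mu]_(s in `[0, t])
      (phi s * (L0 + L1 * \sum_j `|u j s|) + M * \sum_j `|u j s - v j s|))%R).
    apply: le_Rintegral => //.
    - by apply: integrable_normr => //; exact: integrable_subr.
    - by apply: integrable_addr => //; exact: integrable_mulrl.
    - by move=> s st; exact: pointwise.
  rewrite RintegralD//; last exact: integrable_mulrl.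
  rewrite lerD2l RintegralZl// ler_pM2l// Rintegral_sum//.
  apply: ler_sum => j _; apply: ler_Rintegral_itv => //.
  apply: integrable_normr => //; apply: integrable_subr => //;
    [exact: integrable_subitv (iu j)|exact: integrable_subitv (iv j)].
rewrite /phi /dist1; apply: (@le_trans _ _ (\sum_(i < d) (J + M * D))).
  exact: ler_sum.
rewrite sumr_const card_ord -mulr_natl mulrDr addrC lerD//.
  by rewrite mulrA ler_wpM2r// ler_pM2r// ler_nat.
rewrite -RintegralZl//; apply: le_Rintegral => //; first exact: integrable_mulrl.
by move=> s _; rewrite /k mulrCA.
Qed.

Corollary controlled_solution_continuous_control u x : dens u -> controlled_solution u x ->
  forall e : R, 0 < e -> exists2 delta : R, 0 < delta &
    forall v y, dens v -> controlled_solution v y ->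
    (forall j, (\int[mu]_(s in `[0, T]) `|u j s - v j s|)%R < delta) ->
    forall t, t \in `[0, T] -> dist1 x y t < e.
Proof.
move=> iu sx e e0; have [C C0 stable] := controlled_solution_stable iu sx.
have TT : T \in `[0, T] by rewrite in_itv/= T0 lexx.
have me : 0 < Num.min 1 e by rewrite lt_min ltr01.
exists (Num.min 1 e / C / m.+1%:R) => [|v y iv sy uv t tT].
  by rewrite !divr_gt0.
have : C * (\sum_j (\int[mu]_(s in `[0, T]) `|u j s - v j s|)%R) < Num.min 1 e.
  rewrite mulrC -ltr_pdivlMr//.
  apply: (@le_lt_trans _ _ (\sum_(j < m) (Num.min 1 e / C / m.+1%:R))).
    by apply: ler_sum => j _; exact/ltW/uv.
  rewrite sumr_const card_ord -(mulr_natr _ m) mulrAC ltr_pdivrMr//.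
  by rewrite ltr_pM2l ?divr_gt0// ltr_nat.
rewrite lt_min => /andP[D1 De]; apply: le_lt_trans De.
exact: (stable v y iv sy T TT).
Qed.

Corollary controlled_solution_unique u v x y tau : dens u -> dens v ->
  controlled_solution u x -> controlled_solution v y -> tau \in `[0, T] ->
  (forall j, (\int[mu]_(s in `[0, tau]) `|u j s - v j s|)%R = 0) ->
  x tau = y tau.
Proof.
move=> iu iv sx sy tauT uv; have [C C0 stable] := controlled_solution_stable iu sx.
have := stable v y iv sy tau tauT; rewrite /= big1// mulr0 => /(_ ltr01 tau).
rewrite in_itv/= lexx andbT; move: (tauT); rewrite in_itv/= => /andP[-> _] /(_ isT).
move=> d0; apply/eqP; rewrite -subr_eq0; apply/eqP/enorm0_eq0/le_anti.
by rewrite enorm_ge0 andbT (le_trans (enorm_dist1 _ _ _)).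
Qed.

End controlled_equation.


(** * Word integrals determine the densities *)

Section vanishing_densities.
Context {R : realType}.
Let mu := @lebesgue_measure R.
Implicit Types (t : R) (h H G : R -> R).

Lemma Rintegral_itv_cst (a b c : R) : a <= b ->
  (\int[mu]_(s in `[a, b]) c)%R = c * (b - a).
Proof.
move=> ab; rewrite Rintegral_cst//= lebesgue_measure_itv/= lte_fin.
by move: ab; rewrite le_eqVlt => /predU1P[->|->//]; rewrite ltxx subrr.
Qed.

Lemma Rintegral_sqr_eq0 t H : {within `[0, t], continuous H} ->
  (\int[mu]_(s in `[0, t]) (H s * H s))%R = 0 -> 0 < t ->
  forall r, r \in `[0, t] -> H r = 0.
Proof.
move=> cH H0 t0 r rt; apply/eqP; apply: contraT => Hr.
pose Q s := H s * H s.
have cQ : {within `[0, t], continuous Q} by move=> s; apply: cvgM; exact: cH.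
have iQ : mu.-integrable `[0, t] (EFin \o Q).
  by apply: continuous_compact_integrable => //; exact: segment_compact.
have Qr : 0 < Q r by rewrite /Q -expr2 exprn_even_gt0.
have Q0 s : 0 <= Q s by rewrite /Q -expr2 sqr_ge0.
have Q20 : 0 < Q r / 2 by rewrite divr_gt0.
have /within_continuous_near/(_ _ rt _ Q20)/nbhs_ballP[d /= d0 near] := cQ.
have d20 : 0 < d / 2 by rewrite divr_gt0.
have /andP[r0 rt'] : 0 <= r <= t by move: rt; rewrite in_itv.
pose p := Num.max 0 (r - d / 2); pose q := Num.min t (r + d / 2).
have p0 : 0 <= p by rewrite le_max lexx.
have qt : q <= t by rewrite ge_min lexx.
have pr : p <= r by rewrite ge_max r0/=; lra.
have rq : r <= q by rewrite le_min rt'/=; lra.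
have pq : p < q.
  by rewrite gt_max !lt_min; apply/andP; split; apply/andP; split; lra.
have Qpq s : s \in `[p, q] -> Q r / 2 <= Q s.
  rewrite in_itv/= => /andP[ps sq].
  have : `|Q r - Q s| < Q r / 2.
    apply: near; last by rewrite /= in_itv/= (le_trans p0 ps) (le_trans sq qt).
    have : r - d / 2 <= p by rewrite le_max lexx orbT.
    have : q <= r + d / 2 by rewrite ge_min lexx orbT.
    by rewrite /ball/= ltr_norml => *; apply/andP; split; lra.
  by rewrite ltr_norml => /andP[? ?]; lra.
have : Q r / 2 * (q - p) <= (\int[mu]_(s in `[p, q]) Q s)%R.
  rewrite -Rintegral_itv_cst; last exact: ltW.
  apply: le_Rintegral => //; last exact: integrable_subitv iQ.
  apply: continuous_compact_integrable; first exact: segment_compact.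
  by apply: continuous_subspaceT => ?; exact: cst_continuous.
have := H0; rewrite -/(Q) (Rintegral_itv_cat p0 _ iQ); last by rewrite (le_trans (ltW pq)).
rewrite (Rintegral_itv_cat (ltW pq) qt); last exact: integrable_subitv iQ.
have : 0 < Q r / 2 * (q - p) by rewrite mulr_gt0// subr_gt0.
have : 0 <= (\int[mu]_(s in `[0, p]) Q s)%R by exact: Rintegral_ge0.
have : 0 <= (\int[mu]_(s in `[q, t]) Q s)%R by exact: Rintegral_ge0.
by lra.
Qed.

(** By the Lebesgue differentiation theorem, [h] is almost everywhere the
derivative of its primitive. *)
Lemma Rintegral_norm_eq0 t h : mu.-integrable `[0, t] (EFin \o h) ->
  (forall r, r \in `[0, t] -> (\int[mu]_(s in `[0, r]) h s)%R = 0) ->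
  (\int[mu]_(s in `[0, t]) `|h s|)%R = 0.
Proof.
move=> ih h0; pose g := h \_ `[0, t].
have ig : mu.-integrable setT (EFin \o g).
  have := ih; rewrite integrable_mkcond//; congr (_.-integrable _ _).
  by apply/funext => s; rewrite /g /patch/=; case: ifP.
have lg : locally_integrable setT g by exact: integrable_locally.
have igy y : mu.-integrable [set` Interval (BLeft 0) (BRight y)] (EFin \o g).
  by apply: integrableS ig => //; exact: measurableT.
have aeg := FTC1 igy lg.
have mh : measurable_fun `]0, t[ (fun s => `|h s|%:E).
  apply: (@measurable_funS _ _ _ _ `[0, t]%classic) => //.
    by apply: subset_itvScc; rewrite bnd_simp.
  exact: (measurable_int mu (integrable_normr (measurable_itv _) ih)).
rewrite /Rintegral integral_itv_bndoo// (ae_eq_integral (cst 0%E))//.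
  by rewrite integral0.
move: aeg; apply: filterS; first exact: (ae_filter_ringOfSetsType (@lebesgue_measure R)).
move=> r gr /=; rewrite in_itv/= => /andP[r0 rt].
have [|_] := gr _; first by rewrite lte_fin.
rewrite derive1E (near_eq_derive (g := cst 0)) ?derive_cst//.
  rewrite /g patchE ifT; last by rewrite inE/= in_itv/= !ltW.
  by move=> <-; rewrite normr0.
have : \forall y \near r, y \in `]0, t[.
  by apply: near_in_itvoo; rewrite in_itv/= r0.
apply: filterS => y; rewrite in_itv/= => /andP[y0 yt] /=.
rewrite -[RHS](h0 y); last by rewrite in_itv/= !ltW.
apply: eq_Rintegral => s; rewrite inE/= in_itv/= => /andP[s0 sy].
by rewrite /g patchE ifT// inE/= in_itv/= s0 (le_trans sy (ltW yt)).
Qed.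

End vanishing_densities.

Section signature_determines_densities.
Context {R : realType} {I : eqType}.
Let mu := @lebesgue_measure R.
Implicit Types (t : R) (h k : I -> R -> R).

Lemma word_integral1 h o t : h o =1 cst 1 -> 0 <= t -> word_integral h [:: o] t = t.
Proof.
move=> ho t0 /=; under eq_Rintegral do rewrite ho mul1r.
by rewrite Rintegral_itv_cst// mul1r subr0.
Qed.

(** The words in the single letter [o] span the polynomials in time, which are
dense in the continuous functions by [stone_weierstrass]. Their products with
h a and with k a have the same integrals, which are words too; so
phi = h a - k a is orthogonal to all continuous functions. For the primitives H of phi and G of H, the product
rule gives H t * G t = \int G phi + \int H ^ 2, where H t = 0 and the first
integral is 0. Thus H vanishes, and phi with it almost everywhere. *)
Theorem word_integrals_determine h k o t : 0 <= t ->
  (forall a, mu.-integrable `[0, t] (EFin \o h a)) ->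
  (forall a, mu.-integrable `[0, t] (EFin \o k a)) ->
  h o =1 cst 1 -> k o =1 cst 1 ->
  (forall w, word_integral h w t = word_integral k w t) ->
  forall a, (\int[mu]_(s in `[0, t]) `|h a s - k a s|)%R = 0.
Proof.
move=> t0 ih ik ho ko hk a; set phi := fun s => h a s - k a s.
have [t00|tpos] := eqVneq t 0; first by rewrite t00 set_itv1 Rintegral_set1.
have {}tpos : 0 < t by rewrite lt_neqAle eq_sym tpos.
have tt : t \in `[0, t] by rewrite in_itv/= t0 lexx.
have iphi : mu.-integrable `[0, t] (EFin \o phi) by exact: integrable_subr.
pose timed (s : seq (R * seq I)) := all (fun cw => all (pred1 o) cw.2) s.
have hok b : pred1 o b -> h b =1 k b by move=> /eqP -> r; rewrite ho ko.
have comb0 s : timed s -> (\int[mu]_(r in `[0, t]) (word_comb h s r * phi r))%R = 0.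
  move=> Ps; transitivity (\int[mu]_(r in `[0, t])
      (word_comb h s r * h a r - word_comb k s r * k a r))%R.
    by apply: eq_Rintegral => r _; rewrite -(eq_word_comb _ hok Ps) /phi; ring.
  rewrite RintegralB//; [|exact: integrable_word_comb_integrand|exact: integrable_word_comb_integrand].
  rewrite !(@Rintegral_word_comb _ _ t)//.
  rewrite /word_comb !big_map; apply/eqP; rewrite subr_eq0; apply/eqP.
  by apply: eq_bigr => cw _; rewrite hk.
pose A : set (R -> R) := [set g | exists2 s, timed s &
  forall r, r \in `[0, t] -> g r = word_comb h s r].
have cont0 (G : R -> R) : {within `[0, t], continuous G} ->
    (\int[mu]_(s in `[0, t]) (G s * phi s))%R = 0.
  move=> cG; set N := (\int[mu]_(s in `[0, t]) `|phi s|)%R.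
  have N0 : 0 <= N by exact: Rintegral_ge0.
  have N1 : 0 < N + 1 by rewrite ltr_wpDl.
  apply/eqP; rewrite -normr_le0; apply/ler_addgt0Pr => e e0; rewrite add0r.
  have [|||||||g [s Ps gs] Gg] := @stone_weierstrass R R `[0, t]%classic A _ _ _ _ _ _ G cG _
    (e / (N + 1)) (divr_gt0 e0 N1).
  - exact: segment_compact.
  - exists [:: (1, [::])] => // r _; by rewrite /word_comb big_seq1 mulr1.
  - move=> f g [s Ps fs] [s' Ps' gs]; exists (s ++ s').
      by rewrite /timed all_cat; apply/andP.
    by move=> r rt; rewrite word_comb_cat fs// gs.
  - move=> f g [s Ps fs] [s' Ps' gs].
    have [s'' Ps'' sE] := @word_comb_mul R I t t0 _ s s' Ps Ps'.
    by exists s'' => // r rt; rewrite fs// gs// sE.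
  - move=> c f [s Ps fs]; exists [seq (c * cw.1, cw.2) | cw <- s].
      by rewrite /timed all_map; exact: sub_all Ps.
    by move=> r rt; rewrite word_combZ fs.
  - move=> f [s Ps fs]; have := @word_comb_continuous _ _ _ t0 h s ih.
    by apply: subspace_eq_continuous => r; rewrite inE => rt; rewrite /from_subspace fs.
  - move=> p q pt qt Gpq; exists (word_integral h [:: o]).
      exists [:: (1, [:: o])]; first by rewrite /timed/= eqxx.
      by move=> r _; rewrite /word_comb big_seq1 mul1r.
    move: pt qt; rewrite /= !in_itv/= => /andP[p0 _] /andP[q0 _].
    have := word_integral1 ho p0; have := word_integral1 ho q0 => /= -> -> pq.
    by apply: Gpq; rewrite pq.
  have -> : (\int[mu]_(r in `[0, t]) (G r * phi r))%R =
      (\int[mu]_(r in `[0, t]) ((G r - word_comb h s r) * phi r))%R.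
    under [RHS]eq_Rintegral do rewrite mulrBl.
    rewrite RintegralB//; first by rewrite comb0// subr0.
      exact: integrable_contM.
    by apply: integrable_contM => //; exact: word_comb_continuous.
  apply: (@le_trans _ _ (e / (N + 1) * N)).
    apply: normr_RintegralM_le => //.
    - by apply: within_continuousB => //; exact: word_comb_continuous.
    - by rewrite ltW// divr_gt0.
    - by move=> r rt; rewrite ltW// -gs// Gg.
  by rewrite mulrAC ler_pdivrMr// ler_pM2l// lerDl.
pose H r := (\int[mu]_(s in `[0%R, r]) phi s)%R.
have cH : {within `[0, t], continuous H} by exact: primitive_within_continuous.
have iH : mu.-integrable `[0, t] (EFin \o H).
  by apply: continuous_compact_integrable => //; exact: segment_compact.
have Ht : H t = 0.
  rewrite /H -[RHS](cont0 (cst 1)); last first.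
    by apply: continuous_subspaceT => ?; exact: cst_continuous.
  by apply: eq_Rintegral => r _; rewrite mul1r.
have := primitive_product_rule iphi iH tt; rewrite /= -/(H t) Ht mul0r cont0; last first.
  exact: primitive_within_continuous.
rewrite add0r => /esym HH; apply: Rintegral_norm_eq0 => // r rt.
exact: Rintegral_sqr_eq0 HH tpos r rt.
Qed.

End signature_determines_densities.


(** * Square integrable controls *)

Section square_integrable_controls.
Context {R : realType} (T : R) (m : nat).
Implicit Types u v : L2 T m.
Let mu := @lebesgue_measure R.
Let nu := @lebesgue_on R T.

Lemma integral_lebesgue_on (f : R -> \bar R) : measurable_fun setT f ->
  (forall s, 0 <= f s)%E ->
  (\int[@lebesgue_on R T]_s f s = \int[@lebesgue_measure R]_(s in `[0%R, T]) f s)%E.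
Proof.
move=> mf f0.
have nu0 : nu (~` `[0, T]%classic) = 0%E.
  by rewrite /nu /lebesgue_on /mrestr setICl measure0.
rewrite (@ge0_negligible_integral _ _ _ nu setT (~` `[0, T]%classic))//; last first.
  exact: measurableC.
rewrite setTD setCK; apply: eq_measure_integral => A mA AT.
by rewrite /= /lebesgue_on /mrestr setIidl.
Qed.

Lemma lebesgue_on_finite : nu setT \is a fin_num.
Proof.
rewrite /nu /lebesgue_on /mrestr setTI lebesgue_measure_itv/=.
by case: ifP.
Qed.

Lemma measurable_L2 u i : measurable_fun setT (u i : R -> R).
Proof. exact: (@measurable_funPT _ _ _ _ (repr (LebesgueSpace.sort (u i)))). Qed.

Lemma L2_Lfun u i : (u i : R -> R) \in Lfun nu 2%:E.
Proof.
rewrite inE; apply/andP; split; apply: mem_set; first exact: measurable_L2.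
exact: Lebesgue_finite.
Qed.

Lemma L2_integrable u i : mu.-integrable `[0, T] (EFin \o (u i : R -> R)).
Proof.
have /(Lfun_subset12 lebesgue_on_finite)/Lfun1_integrable/integrableP[mf foo] := L2_Lfun u i.
apply/integrableP; split.
  by apply: measurable_funTS; apply/measurable_EFinP; exact: measurable_L2.
rewrite -integral_lebesgue_on//.
by apply: measurableT_comp => //; exact: mf.
Qed.

Let err u v s := enorm (L2fun u s - L2fun v s).

Let err_sqr u v s : err u v s ^+ 2 = \sum_i (u i s - v i s) ^+ 2.
Proof.
rewrite /err enorm_sqr; apply: eq_bigr => i _.
by rewrite big_ord1 !mxE.
Qed.

Let measurable_err u v : measurable_fun setT (err u v).
Proof.
rewrite (_ : err u v = fun s => Num.sqrt (\sum_i (u i s - v i s) ^+ 2)); last first.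
  by apply/funext => s; rewrite -err_sqr sqrtr_sqr ger0_norm// enorm_ge0.
apply: measurableT_comp => //.
  exact: (continuous_measurable_fun (@sqrt_continuous R)).
apply: measurable_sum => i; apply: measurable_funX.
by apply: measurable_funB; exact: measurable_L2.
Qed.

Let err_finite u v : (Lnorm nu 2%:E (EFin \o err u v) < +oo)%E.
Proof.
have isqr i : nu.-integrable setT (EFin \o (fun s => (u i s - v i s) ^+ 2)).
  apply: (@Lfun2_integrable_sqr _ _ _ nu (fun s => u i s - v i s)).
  have Nv := Lfun_oppr_closed (L2_Lfun v i).
  exact: ((Lfun_addr_closed nu (lee1n 2)).2 _ _ (L2_Lfun u i) Nv).
(* finiteness matters because L2dist would read an infinite norm as 0 *)
have /integrableP[_] : nu.-integrable setT (fun s => \sum_i ((u i s - v i s) ^+ 2)%:E)%E.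
  by apply: integrable_sum => [|i _]; [exact: measurableT|exact: isqr].
move=> soo; rewrite unlock; apply: poweR_lty; apply: le_lt_trans soo.
rewrite le_eqVlt; apply/orP; left; apply/eqP; apply: eq_integral => s _.
rewrite sumEFin/= -err_sqr powR_mulrn ?normr_ge0// real_normK ?num_real//.
by rewrite ger0_norm// sqr_ge0.
Qed.

Let L2distE u v : (L2dist u v)%:E = Lnorm nu 2%:E (EFin \o err u v).
Proof. by rewrite /L2dist fineK// ge0_fin_numE ?Lnorm_ge0// err_finite. Qed.

(** Hoelder's inequality against the constant function 1. *)
Lemma L1_le_L2dist : exists2 C : R, 0 < C & forall u v j,
  (\int[mu]_(s in `[0%R, T]) `|u j s - v j s|)%R <= C * L2dist u v.
Proof.
have one_fin : (Lnorm nu 2%:E (EFin \o cst 1%R) < +oo)%E.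
  have := @Lnorm_cst1 _ _ _ nu 2; rewrite (_ : cst 1%E = EFin \o cst 1%R)// => ->.
  by apply: poweR_lty; rewrite ltey_eq lebesgue_on_finite.
have one0 := Lnorm_ge0 nu 2%:E (EFin \o cst 1%R).
exists (fine (Lnorm nu 2%:E (EFin \o cst 1%R)) + 1) => [|u v j].
  by rewrite ltr_wpDl// fine_ge0.
have iuv : mu.-integrable `[0, T] (EFin \o (fun s => `|u j s - v j s|)).
  by apply: integrable_normr => //; apply: integrable_subr => //; exact: L2_integrable.
have d0 : 0 <= L2dist u v by rewrite -lee_fin L2distE Lnorm_ge0.
rewrite mulrDl mul1r (@le_trans _ _ (fine (Lnorm nu 2%:E (EFin \o cst 1%R)) * L2dist u v))//; last first.
  by rewrite lerDl.
rewrite -lee_fin EFinM [(fine (Lnorm _ _ _))%:E]fineK; last by rewrite (ge0_fin_numE one0); exact: one_fin.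
rewrite L2distE muleC.
have fin : (\int[mu]_(s in `[0%R, T]) `|u j s - v j s|%:E)%E \is a fin_num.
  exact: integrable_fin_num iuv.
rewrite /Rintegral fineK//.
have half : ((2 : R)^-1 + 2^-1 = 1)%R by field.
have := @hoelder _ _ _ nu _ _ 2 2 (measurable_err u v) (measurable_cst (1 : R)) (ltr0Sn _ 1) (ltr0Sn _ 1) half.
apply: le_trans; rewrite Lnorm1 -integral_lebesgue_on//; last first.
  apply/measurable_EFinP; apply: measurableT_comp => //.
  by apply: measurable_funB; exact: measurable_L2.
apply: ge0_le_integral => //.
- apply/measurable_EFinP; apply: measurableT_comp => //.
  by apply: measurable_funB; exact: measurable_L2.
- apply: measurableT_comp => //; apply/measurable_EFinP; apply: measurable_funM => //.
  exact: measurable_err.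
- move=> s _ /=; rewrite lee_fin mulr1 (le_trans _ (ler_norm _))//.
  have := normr_le_enorm (L2fun u s - L2fun v s) j 0; by rewrite !mxE.
Qed.

End square_integrable_controls.


(** * Coordinates of the signature *)

Section signature_entries.
Context {R : realType} {M : nat}.
Let mu := @lebesgue_measure R.
Implicit Types (h : 'I_M -> R -> R) (X : R -> 'cV[R]_M) (S : tensor_series R M).

(** The position of a word in the Kronecker indexing of R ^ (M ^ k), where
[expnSr] is the identification used by [iterated_integral]. *)
Fixpoint word_index (w : seq 'I_M) : 'I_(M ^ size w) :=
  match w return 'I_(M ^ size w) with
  | [::] => ord0
  | a :: w' => cast_ord (esym (expnSr M (size w'))) (mxtens_index (word_index w', a))
  end.

Lemma iterated_integralE (T : R) h X w t :
  (forall a, mu.-integrable `[0, T] (EFin \o h a)) ->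
  (forall a s, s \in `[0, T] -> X s a 0 = (\int[mu]_(r in `[0, s]) h a r)%R) ->
  t \in `[0, T] ->
  iterated_integral X (size w) 0 t (word_index w) 0 = word_integral h w t.
Proof.
move=> ih XE; elim: w t => [|a w IH] t; first by rewrite /= mxE.
rewrite in_itv/= => /andP[t0 tT].
rewrite castmxE/= !mxE cast_ordK mxtens_indexK/=.
have T0 : 0 <= T by exact: le_trans tT.
have sub s : s \in `[0, t] -> s \in `[0, T].
  by rewrite !in_itv/= => /andP[-> /le_trans]; exact.
have -> : (\int[mu]_(s in `[0, t]) (word_integral h w s * h a s))%R =
  (\int[mu]_(s in `[0, t]) (iterated_integral X (size w) 0 s (word_index w) 0 * h a s))%R.
  by apply: eq_Rintegral => s; rewrite inE => /sub sT; rewrite IH.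
apply: RSintE => //; apply: is_RSint_primitive.
- exact: integrable_subitv (ih a).
- have cw := within_continuous_itvS (lexx 0) tT (word_integral_continuous (w := w) T0 ih).
  move: cw; apply: subspace_eq_continuous => s; rewrite inE => /sub sT.
  by rewrite /from_subspace IH.
- move=> c d c0 cd dt; have dT := le_trans dt tT.
  rewrite !XE ?in_itv/= ?c0 ?dT ?(le_trans c0 cd) ?(le_trans cd dT)//.
  exact: Rintegral_itv_increment (ih a) _ _ _.
Qed.

Lemma pairing_trunc (l : tensor_poly R M) S n :
  (forall k, (n <= k)%N -> tcoef l k = 0) ->
  pairing l S = \sum_(k < n) dotp (tcoef l k) (S k).
Proof.
move=> l0; rewrite (@fsbig_ord _ _ _ n (fun k => dotp (tcoef l k) (S k))) /pairing; apply/esym/fsbig_widen => //.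
move=> k [_ /= /negP]; rewrite -leqNgt => /l0 lk.
by rewrite /dotp big1// => i _; rewrite lk mxE mul0r.
Qed.

(** The entries of the coefficient tensor are compared as natural numbers, since
words of different lengths have indices of different types. *)
Lemma pairing_words (s : seq (R * seq 'I_M)) : exists l : tensor_poly R M,
  forall S, pairing l S = \sum_(cw <- s) cw.1 * S (size cw.2) (word_index cw.2) 0.
Proof.
pose n := (\max_(cw <- s) size cw.2).+1.
pose coef (k : nat) (q : 'I_(M ^ k)) (cw : R * seq 'I_M) : R :=
  if (size cw.2 == k) && (val (word_index cw.2) == val q) then cw.1 else 0.
pose c : tensor_series R M := fun k => \col_q \sum_(cw <- s) coef k q cw.
have size_n cw : cw \in s -> (size cw.2 < n)%N.
  move=> cws; rewrite ltnS.
  by apply: (@leq_bigmax_seq _ s xpredT (fun cw => size cw.2) cw cws).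
have c0 k : (n <= k)%N -> c k = 0.
  move=> nk; apply/matrixP => q j; rewrite !mxE big_seq big1// => cw /size_n sn.
  by rewrite /coef ifF//; apply/negP => /andP[/eqP sk _]; move: sn; rewrite sk ltnNge nk.
have fin : finite_set [set k | c k != 0].
  apply: (sub_finite_set _ (finite_II n)) => k /= ck.
  by rewrite ltnNge; apply: contra ck => /c0 ->.
exists (TensorPoly fin) => S; rewrite (@pairing_trunc (TensorPoly fin) S n c0)/=.
under eq_bigr => k _.
  rewrite /dotp; under eq_bigr => q _ do rewrite mxE mulr_suml.
  rewrite exchange_big/=; over.
rewrite exchange_big/= big_seq [RHS]big_seq; apply: eq_bigr => cw cws.
rewrite (bigD1 (Ordinal (size_n cw cws)))//= [X in _ + X]big1 ?addr0.
  rewrite (bigD1 (word_index cw.2))//= big1 ?addr0 => [|q qw].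
    by rewrite /coef !eqxx.
  rewrite /coef eqxx/= ifF ?mul0r//; apply: contraNF qw => /eqP qw.
  exact/eqP/val_inj/esym.
move=> k kw; rewrite big1// => q _; rewrite /coef ifF ?mul0r//.
by apply/negP => /andP[/eqP sk _]; case/eqP: kw; exact: val_inj.
Qed.

End signature_entries.

Section time_augmentation.
Context {R : realType} (T : R) (m : nat).
Implicit Types u v : L2 T m.
Let mu := @lebesgue_measure R.

Definition augmented_density u (a : 'I_m.+1) : R -> R :=
  if unlift ord0 a is Some j then (u j : R -> R) else cst 1.

Lemma augmented_density0 u : augmented_density u ord0 = cst 1.
Proof. by rewrite /augmented_density unlift_none. Qed.

Lemma augmented_density_lift u j : augmented_density u (lift ord0 j) = u j.
Proof. by rewrite /augmented_density liftK. Qed.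

Lemma augmented_density_integrable u a :
  mu.-integrable `[0, T] (EFin \o augmented_density u a).
Proof.
case: (unliftP ord0 a) => [j|] ->; last first.
  rewrite augmented_density0; apply: continuous_compact_integrable.
    exact: segment_compact.
  by apply: continuous_subspaceT => ?; exact: cst_continuous.
by rewrite augmented_density_lift; exact: L2_integrable.
Qed.

Lemma time_augmentedE u a t : t \in `[0, T] ->
  time_augmented u t a 0 = (\int[mu]_(s in `[0, t]) augmented_density u a s)%R.
Proof.
rewrite in_itv/= => /andP[t0 tT]; rewrite /time_augmented.
case: (unliftP ord0 a) => [j|] ->.
  rewrite augmented_density_lift (_ : lift ord0 j = rshift 1 j); last exact: val_inj.
  transitivity (primitive u t j 0); first exact: col_mxEd.
  by rewrite mxE; apply: eq_Rintegral => s _; rewrite mxE.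
rewrite augmented_density0 (_ : (ord0 : 'I_m.+1) = lshift m (ord0 : 'I_1)); last exact: val_inj.
transitivity ((t%:M : 'M[R]_1) ord0 0); first exact: col_mxEu.
by rewrite mxE eqxx mulr1n Rintegral_itv_cst// mul1r subr0.
Qed.

Lemma signature_word u w t : t \in `[0, T] ->
  signature 0 t (time_augmented u) (size w) (word_index w) 0 =
  word_integral (augmented_density u) w t.
Proof.
move=> tT; apply: iterated_integralE tT => [a|a s sT].
  exact: augmented_density_integrable.
exact: time_augmentedE.
Qed.

(** F (t, u) - F (s, v) is split at F (s, u): the time moves with the control [u]
fixed, then the control moves at the time [s], which is why the second
hypothesis is uniform in time. *)
Lemma within_continuous_controls (K : set (L2 T m)) (F : R * L2 T m -> R) :
  (forall u, {within `[0, T], continuous (fun t => F (t, u))}) ->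
  (forall u (e : R), 0 < e -> exists2 delta : R, 0 < delta & forall v,
    (forall j, (\int[mu]_(s in `[0, T]) `|u j s - v j s|)%R < delta) ->
    forall t, t \in `[0, T] -> `|F (t, u) - F (t, v)| < e) ->
  {within `[0, T] `*` K, continuous F}.
Proof.
move=> ct cu; apply/within_continuous_near => -[t u] [/= tT Ku] e e0.
have e20 : 0 < e / 2 by rewrite divr_gt0.
have [d d0 ud] := cu u _ e20; have [C C0 L1C] := @L1_le_L2dist R T m.
have near_t := (within_continuous_near _ _).1 (ct u) t tT _ e20.
have near_u : nbhs u (ball u (d / C)) by apply: nbhsx_ballx; exact: divr_gt0.
exists ([set s | `[0, T]%classic s -> `|F (t, u) - F (s, u)| < e / 2],
  ball u (d / C)) => //= -[s v] [/= ns nv] [/= sT Kv].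
have uv j : (\int[mu]_(s in `[0, T]) `|u j s - v j s|)%R < d.
  apply: le_lt_trans (L1C u v j) _; rewrite mulrC -ltr_pdivlMr//.
have := ns sT; have := ud v uv s sT.
by rewrite !ltr_norml => /andP[? ?] /andP[? ?]; apply/andP; split; lra.
Qed.

Lemma word_comb_continuous_controls (T0 : 0 <= T) (K : set (L2 T m))
    (s : seq (R * seq 'I_m.+1)) :
  {within `[0, T] `*` K, continuous
    (fun p => word_comb (augmented_density p.2) s p.1)}.
Proof.
apply: within_continuous_controls => [u|u].
  exact: (@word_comb_continuous _ _ _ T0 _ s (augmented_density_integrable u)).
elim: s => [|[c w] s IH] e e0.
  by exists 1 => // v _ t _; rewrite /word_comb !big_nil subrr normr0.
have e20 : 0 < e / 2 by rewrite divr_gt0.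
have c1 : 0 < `|c| + 1 by rewrite ltr_wpDl.
have [d d0 ds] := IH _ e20.
have [d' d'0 dw] := word_integral_stable T0 w
  (augmented_density_integrable u) (divr_gt0 e20 c1).
exists (Num.min d d') => [|v uv t tT]; first by rewrite lt_min d0.
have {}ds : `|word_comb (augmented_density u) s t -
    word_comb (augmented_density v) s t| < e / 2.
  by apply: ds tT => j; have := uv j; rewrite lt_min => /andP[].
have {}dw : `|word_integral (augmented_density u) w t -
    word_integral (augmented_density v) w t| < e / 2 / (`|c| + 1).
  apply: dw tT; first exact: augmented_density_integrable.
  move=> a; case: (unliftP ord0 a) => [j|] ->; last first.
    under eq_Rintegral do rewrite !augmented_density0 subrr normr0.
    by rewrite Rintegral_cst// mul0r.
  by rewrite !augmented_density_lift; have := uv j; rewrite lt_min => /andP[].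
rewrite /= !word_comb_cons/= opprD addrACA -mulrBr.
rewrite (le_lt_trans (ler_normD _ _))// (splitr e) ler_ltD// normrM.
apply: (@le_trans _ _ (`|c| * (e / 2 / (`|c| + 1)))); first by rewrite ler_wpM2l// ltW.
rewrite mulrCA; apply: ler_piMr; first exact: ltW.
by rewrite ler_pdivrMr// mul1r lerDl.
Qed.

End time_augmentation.

(** * Approximation of the outputs *)

Section outputs.
Context {R : realType} (T : R) (d m p : nat) (x0 : 'cV[R]_d)
  (f0 : 'cV[R]_d -> 'cV[R]_d) (f : 'cV[R]_d -> 'M[R]_(d, m))
  (c : 'cV[R]_d -> 'cV[R]_p).
Hypotheses (T0 : 0 <= T) (hf0 : locally_lipschitz f0) (hf : locally_lipschitz f)
  (hc : locally_lipschitz c).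
Let mu := @lebesgue_measure R.
Local Notation solution := (controlled_solution T x0 f0 f).

Lemma is_solution_controlled (u : L2 T m) x : is_solution x0 f0 f u x ->
  solution (fun j => u j : R -> R) x.
Proof.
move=> [_ sx] t tT i; have [ix xt] := sx t tT.
have E : controlled_rhs f0 f (fun j => u j : R -> R) x i =
    (fun s => (f0 (x s) + f (x s) *m L2fun u s) i 0).
  apply/funext => s; rewrite /controlled_rhs !mxE; congr (_ + _).
  by apply: eq_bigr => j _; rewrite mxE.
by rewrite E; split; [exact: (ix i)|rewrite xt !mxE].
Qed.

(** [c] is Lipschitz on a ball that contains a unit tube around the trajectory. *)
Lemma output_modulus u x i (e : R) : solution u x -> 0 < e ->
  exists2 delta : R, 0 < delta & forall t z, t \in `[0, T] ->
    enorm (x t - z) < delta -> `|c (x t) i 0 - c z i 0| < e.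
Proof.
move=> sx e0; have [r r0 xr] := controlled_solution_bounded T0 sx.
have [L L0 cL] := hc (ltr_wpDl (ltW r0) ltr01).
exists (Num.min 1 (e / L)) => [|t z tT]; first by rewrite lt_min ltr01 divr_gt0.
rewrite lt_min => /andP[xz1 xze].
have zr : enorm z <= r + 1.
  rewrite (_ : z = x t + - (x t - z)); last by rewrite opprB addrC subrK.
  by rewrite (le_trans (ler_enormD _ _))// lerD ?xr// enormN ltW.
have := normr_le_enorm (c (x t) - c z) i 0; rewrite !mxE => /le_lt_trans; apply.
apply: le_lt_trans (cL _ _ _ zr) _; first by rewrite (le_trans (xr t tT))// lerDl.
by rewrite mulrC -ltr_pdivlMr.
Qed.

Lemma output_continuous u x i : solution u x ->
  {within `[0, T], continuous (fun t => c (x t) i 0)}.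
Proof.
move=> sx; apply/within_continuous_near => t tT e e0.
have [delta d0 cd] := output_modulus i sx e0.
have : {within `[0, T], continuous (dist1 x (cst (x t)))}.
  apply: within_continuous_sum_norm => j.
  apply: within_continuousB; first exact: controlled_solution_continuous sx.
  by apply: continuous_subspaceT => ?; exact: cst_continuous.
move=> /within_continuous_near/(_ t tT _ d0); apply: filterS => s st sT.
apply: cd => //; rewrite -enormN opprB.
apply: le_lt_trans (enorm_dist1 x (cst (x t)) s) _.
have := st sT; rewrite {1}/dist1 big1 => [|j _]; last by rewrite subrr normr0.
by rewrite sub0r normrN; apply: le_lt_trans; exact: ler_norm.
Qed.

Lemma output_stable (u : 'I_m -> R -> R) x i :
  (forall j, mu.-integrable `[0, T] (EFin \o u j)) -> solution u x ->
  forall e : R, 0 < e -> exists2 delta : R, 0 < delta & forall v y,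
    (forall j, mu.-integrable `[0, T] (EFin \o v j)) -> solution v y ->
    (forall j, (\int[mu]_(s in `[0, T]) `|u j s - v j s|)%R < delta) ->
    forall t, t \in `[0, T] -> `|c (x t) i 0 - c (y t) i 0| < e.
Proof.
move=> iu sx e e0; have [eta eta0 ceta] := output_modulus i sx e0.
have [delta d0 xd] := controlled_solution_continuous_control T0 hf0 hf iu sx eta0.
exists delta => // v y iv sy uv t tT; apply: ceta => //.
exact: le_lt_trans (enorm_dist1 x y t) (xd v y iv sy uv t tT).
Qed.

End outputs.

Theorem corollary3p11 (R : realType) (T : R) (hT : 0 < T) (d m p : nat)
    (x0 : 'cV[R]_d) (f0 : 'cV[R]_d -> 'cV[R]_d) (f : 'cV[R]_d -> 'M[R]_(d, m))
    (c : 'cV[R]_d -> 'cV[R]_p)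
    (hf0 : locally_lipschitz f0) (hf : locally_lipschitz f)
    (hc : locally_lipschitz c)
    (hgrowth : exists C : R, forall x : 'cV[R]_d,
      2 * dotp x (f0 x) + enorm (f x) ^+ 2 <= C * (1 + enorm x ^+ 2))
    (x : L2 T m -> R -> 'cV[R]_d)
    (hx : forall u : L2 T m, is_solution x0 f0 f u (x u))
    (K : set (L2 T m)) (hK : compact K) (i : 'I_p) (e : R) (he : 0 < e) :
  exists l : tensor_poly R m.+1,
    (ereal_sup [set ereal_sup
      [set (`|c (x u t) i 0 - pairing l (signature 0 t (time_augmented u))|%R)%:E
        | u in K] | t in `[0%R, T]] < e%:E)%E.
Proof.
have T0 : 0 <= T by exact: ltW.
have sx u := is_solution_controlled (hx u).
have iu (u : L2 T m) j := @L2_integrable R T m u j.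
have e20 : 0 < e / 2 by rewrite divr_gt0.
have allT (s : seq (R * seq 'I_m.+1)) : all (fun cw => all xpredT cw.2) s.
  by elim: s => //= cw s ->; rewrite all_predT.
pose F (q : R * L2 T m) := c (x q.2 q.1) i 0.
pose A : set (R * L2 T m -> R) := [set g | exists s, forall q, q.1 \in `[0, T] ->
  g q = word_comb (augmented_density q.2) s q.1].
have [|||||||| g [s gs] Fg] := @stone_weierstrass R _ (`[0, T] `*` K) A _ _ _ _ _ _ F _ _ _ e20.
- by apply: compact_setX => //; exact: segment_compact.
- by exists [:: (1, [::])] => q _; rewrite /word_comb big_seq1 mulr1.
- move=> g1 g2 [s1 g1E] [s2 g2E]; exists (s1 ++ s2) => q qT.
  by rewrite word_comb_cat g1E// g2E.
- move=> g1 g2 [s1 g1E] [s2 g2E].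
  have [s3 _ s3E] := @word_comb_mul R _ T T0 xpredT s1 s2 (allT s1) (allT s2).
  exists s3 => q qT; rewrite g1E// g2E// s3E// => a.
  exact: augmented_density_integrable.
- move=> k g1 [s1 g1E]; exists [seq (k * cw.1, cw.2) | cw <- s1] => q qT.
  by rewrite word_combZ g1E.
- move=> g1 [s1 g1E]; have := @word_comb_continuous_controls R T m T0 K s1.
  apply: subspace_eq_continuous => q; rewrite inE => -[/= qT _].
  by rewrite /from_subspace g1E.
- apply: within_continuous_controls => [u|u eta eta0].
    exact: (output_continuous T0 hc (i:=i) (sx u)).
  have [delta d0 cd] := output_stable T0 hf0 hf hc i (iu u) (sx u) eta0.
  by exists delta => // v uv t tT; apply: cd (iu v) (sx v) uv t tT.
- move=> [t u] [r v] [/= tT _] [/= rT _] Fne.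
  apply: contrapT => nsep; apply: Fne.
  have words w : word_integral (augmented_density u) w t =
                 word_integral (augmented_density v) w r.
    apply: contrapT => wne; apply: nsep.
    exists (fun q => word_integral (augmented_density q.2) w q.1) => //.
    by exists [:: (1, w)] => q _; rewrite /word_comb big_seq1 mul1r.
  have /andP[t0 tT'] : 0 <= t <= T by move: tT; rewrite in_itv.
  have /andP[r0 _] : 0 <= r <= T by move: rT; rewrite in_itv.
  have aug0 (w : L2 T m) : augmented_density w ord0 =1 cst 1 :> (R -> R).
    by rewrite augmented_density0.
  have tr : t = r by have := words [:: ord0]; rewrite !word_integral1.
  rewrite -{}tr in words *; rewrite /F/=; congr (c _ i 0).
  apply: (controlled_solution_unique T0 hf0 hf (iu u) (iu v) (sx u) (sx v) tT) => j.
  have idens (w : L2 T m) a : (@lebesgue_measure R).-integrable `[0, t] (EFin \o augmented_density w a).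
    exact: (integrable_subitv (lexx 0) tT' (augmented_density_integrable w a)).
  have := word_integrals_determine t0 (idens u) (idens v) (aug0 u) (aug0 v) words
    (lift ord0 j).
  by rewrite !augmented_density_lift.
have [l lE] := pairing_words s; exists l.
apply: (@le_lt_trans _ _ (e / 2)%:E); last by rewrite lte_fin ltr_pdivrMr// ltr_pMr// ltr1n.
apply: ge_ereal_sup => _ [t /= tT <-]; apply: ge_ereal_sup => _ [u Ku <-].
rewrite lee_fin lE; have := Fg (t, u) (conj tT Ku); rewrite gs//=.
have -> : word_comb (augmented_density u) s t = \sum_(cw <- s)
    cw.1 * signature 0 t (time_augmented u) (size cw.2) (word_index cw.2) 0.
  by apply: eq_bigr => cw _; rewrite signature_word.
exact: ltW.
Qed.
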